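(* Let $G$ be a hexagonal graph. For each of the following three families $\mathcal{F}$ of handles, $\mathsf{core}_{\mathcal{F}}(G)=\emptyset$: (1) $\mathcal{F}=\{P(2)\}$; (2) $\mathcal{F}=\{P(4),PP(3)\}$; (3) $\mathcal{F}=\{P(6),PP(3),PP(4),PP(5),S(5,2,1),H(1,2,4,2,1)\}$.
   Context: The triangular lattice is the infinite graph whose vertices are the points of the planar triangular lattice (unit side length), two points being adjacent when at distance 1. A hexagonal graph is a finite triangle-free induced subgraph of the triangular lattice. A handle $P(n)$ of length $n$ in $G$ is a path of length $n$ that is an induced subgraph of $G$ whose vertices of degree 2 in the path have degree 2 in $G$; its interior is the set of its degree-2 vertices. A parity handle $PP(n)$ is a handle $P(n)$ such that $G$ minus the interior of $P(n)$ contains another path of length $m\le n$, $m\equiv n\pmod 2$, between the end-vertices of $P(n)$. An S-handle $S(n_1,n_2,n_3)$ is a handle of length $n_1$ one of whose end-vertices has degree 3 in $G$ and is also the end-vertex of two other handles of lengths $n_2$ and $n_3$. An H-handle $H(n_1,n_2,n,n_3,n_4)$ is a handle of length $n$ whose end-vertices have degree 3 in $G$, one being also the end-vertex of two handles of lengths $n_1,n_2$ and the other of two handles of lengths $n_3,n_4$. For S-/H-handles, the interior means the interior of the central handle (of length $n_1$, resp. $n$). For a family $\mathcal{F}$ of handle types, $\mathsf{core}_{\mathcal{F}}(G)$ is any induced subgraph obtained by successively deleting vertices of degree 0 or 1 and interiors of handles of a type in $\mathcal{F}$, until no vertex of degree 0 or 1 and no handle of a type in $\mathcal{F}$ remains.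 *)

(* Defs.v *)
From HB Require Import structures.
From mathcomp Require Import all_boot all_order all_algebra finmap.
From mathcomp Require Import ring.

Set Implicit Arguments.
Unset Strict Implicit.
Unset Printing Implicit Defensive.

Import Order.TTheory GRing.Theory Num.Theory.

Local Open Scope fset_scope.

(* [HandleP n], [HandlePP n], [HandleS n1 n2 n3] and [HandleH n1 n2 n n3 n4]
   stand for P(n), PP(n), S(n1,n2,n3) and H(n1,n2,n,n3,n4). *)
Inductive handle_type : Type :=
| HandleP of nat
| HandlePP of nat
| HandleS of nat & nat & nat
| HandleH of nat & nat & nat & nat & nat.

Lemma handle_type_comparable : comparable handle_type.
Proof. by rewrite /comparable /decidable; do 2!decide equality. Qed.

HB.instance Definition _ :=
  hasDecEq.Build handle_type (compareP handle_type_comparable).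

(* An induced subgraph of the graph (T, e) is given by its vertex set, a finite
   V : {fset T}.  A path of length n is given by its first vertex x and the
   sequence p, of size n, of the remaining ones. *)
Section InducedSubgraphs.
Variables (T : choiceType) (e : rel T).
Implicit Types (V W C : {fset T}) (x : T) (p q r : seq T).

Definition triangle_free V : Prop :=
  forall x y z, x \in V -> y \in V -> z \in V -> ~ [/\ e x y, e y z & e z x].

Definition degree V x : nat := #|` [fset y in V | e x y]|.

Definition is_path V x p : bool :=
  [&& all (mem V) (x :: p), path e x p & uniq (x :: p)].

Definition chordless x p : Prop :=
  forall i j, i <= size p -> j <= size p ->
  e (nth x (x :: p) i) (nth x (x :: p) j) -> j = i.+1 \/ i = j.+1.

Definition path_vertices x p : {fset T} := [fset y in x :: p].

(* For a chordless path, the degree of a vertex in the path is its degree in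
   the subgraph induced by the vertices of the path. *)
Definition interior x p : {fset T} :=
  [fset y in path_vertices x p | degree (path_vertices x p) y == 2].

Definition is_handle V n x p : Prop :=
  [/\ is_path V x p, size p = n, chordless x p &
      forall y, y \in interior x p -> degree V y = 2].

Definition is_parity_handle V n x p : Prop :=
  is_handle V n x p /\
  exists q, [/\ is_path (V `\` interior x p) x q, last x q = last x p,
                q <> p, size q <= n & size q = n %[mod 2]].

(* x has degree 3 and, besides the path (x, p), is an end-vertex of two handles
   of lengths m1 and m2; the three paths leave x along distinct edges. *)
Definition fork V m1 m2 x p : Prop :=
  degree V x = 3 /\
  exists q r, [/\ is_handle V m1 x q, is_handle V m2 x r &
                  uniq [:: head x p; head x q; head x r]].

(* The reversal of the path (x, p) is (last x p, rev (belast x p)). As handles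
   are considered in both directions, the branching end of an S-handle may be
   taken to be its first vertex. *)
Definition handle_of_type V (t : handle_type) x p : Prop :=
  match t with
  | HandleP n => is_handle V n x p
  | HandlePP n => is_parity_handle V n x p
  | HandleS n1 n2 n3 => is_handle V n1 x p /\ fork V n2 n3 x p
  | HandleH n1 n2 n n3 n4 =>
      [/\ is_handle V n x p, fork V n1 n2 x p &
          fork V n3 n4 (last x p) (rev (belast x p))]
  end.

Variant deletion (F : seq handle_type) V : {fset T} -> Prop :=
| DeleteVertex x of x \in V & degree V x <= 1 : deletion F V (V `\ x)
| DeleteInterior t x p of t \in F & handle_of_type V t x p :
    deletion F V (V `\` interior x p).

Inductive deletions (F : seq handle_type) V : {fset T} -> Prop :=
| NoDeletion : deletions F V V
| OneMoreDeletion W C of deletions F V W & deletion F W C : deletions F V C.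

Definition is_core (F : seq handle_type) V C : Prop :=
  [/\ deletions F V C,
      forall x, x \in C -> 1 < degree C x &
      forall t x p, t \in F -> ~ handle_of_type C t x p].

End InducedSubgraphs.

Section TriangularLattice.
Local Open Scope ring_scope.

(* (a, b) stands for the point a e1 + b e2, where e1 = (1, 0) and
   e2 = (1/2, sqrt 3 / 2). *)
Definition lattice_point : choiceType := (int * int)%type.

Definition sqdist (u v : lattice_point) : int :=
  (u.1 - v.1) ^+ 2 + (u.1 - v.1) * (u.2 - v.2) + (u.2 - v.2) ^+ 2.

Definition lattice_adj : rel lattice_point := fun u v => sqdist u v == 1.

Lemma lattice_adjE (R : rcfType) (u v : lattice_point) :
  let X (w : lattice_point) : R := w.1%:~R + w.2%:~R / 2 in
  let Y (w : lattice_point) : R := w.2%:~R * (Num.sqrt 3 / 2) in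
  lattice_adj u v = (Num.sqrt ((X u - X v) ^+ 2 + (Y u - Y v) ^+ 2) == 1).
Proof.
move=> X Y.
have -> : (X u - X v) ^+ 2 + (Y u - Y v) ^+ 2 = (sqdist u v)%:~R :> R.
  have s3 : Num.sqrt 3 ^+ 2 = 3 :> R by rewrite sqr_sqrtr ?ler0n.
  rewrite /X /Y /sqdist !(rmorphD, rmorphM, rmorphXn, rmorphB) /=.
  rewrite -mulrBl exprMn expr_div_n s3.
  by field; rewrite ?pnatr_eq0.
apply/idP/idP => /eqP; first by move=> ->; rewrite sqrtr1.
case: (lerP 0 (sqdist u v)) => [d0 /(congr1 (fun r : R => r ^+ 2))|d0].
  by rewrite sqr_sqrtr ?ler0z // expr1n => /eqP; rewrite -[1]/(1%:~R) eqr_int.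
by rewrite ler0_sqrtr ?lerz0 ?ltW // => /eqP; rewrite eq_sym oner_eq0.
Qed.

Definition hexagonal (G : {fset lattice_point}) : Prop :=
  triangle_free lattice_adj G.

End TriangularLattice.

(* Main.v *)
Require Import Defs.
From mathcomp Require Import all_boot all_order all_algebra finmap.
From mathcomp Require Import zify ring.

(** The curvature of a finite set [S] of lattice points is six times the Euler
    characteristic of [S] with its edges and unit triangles filled in; equivalently, it is
    the total turning, in units of 60 degrees, of the curves that separate [S]
    from its complement.  Eating away a large parallelogram from outside, without ever
    touching the graph [G], yields a set [S] without holes, all of whose boundary
    vertices lie in [G]: its curvature is at least 6 times its number of components,
    hence positive.

    Walking along the boundary of [S], and assuming minimum degree 2, each vertex is a
    left turn (+1), a straight step (0) or a right turn (-1), and only a right turn can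
    be a vertex of degree 3.  The vertices between two consecutive ones of degree 3
    form the interior of a handle.  If the total turning is positive, then some of these
    words of turns have a large sum, and a finite inspection of the words of bounded
    length shows that this forces one of the handles of the family. *)

Set Implicit Arguments.
Unset Strict Implicit.
Unset Printing Implicit Defensive.

Import Order.TTheory GRing.Theory Num.Theory.

Local Open Scope fset_scope.
Local Open Scope nat_scope.

(** * Handles *)

Section Handles.
Variables (T : choiceType) (e : rel T).
Hypotheses (e_sym : symmetric e) (e_irr : irreflexive e).
Implicit Types (V : {fset T}) (x : T) (p q : seq T).

(** An end-vertex of a chordless path has at most one neighbor on it, so only inner positions can
    have degree 2 in the path. *)
Lemma interior_nth x p y : chordless e x p -> y \in interior e x p ->
  exists2 i, 0 < i < size p & y = nth x (x :: p) i.
Proof.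
move=> chp; rewrite !inE /= => /andP[yp /eqP dy].
have memE z : z \in x :: p ->
    exists2 i, i <= size p & z = nth x (x :: p) i.
  move=> zp; exists (index z (x :: p)); last by rewrite nth_index.
  by rewrite -ltnS -[(size p).+1]/(size (x :: p)) index_mem.
have [i ip yE] : exists2 i, i <= size p & y = nth x (x :: p) i.
  by apply: memE; rewrite inE.
exists i => //; apply/negPn/negP => end_i.
have [k nbr_k] : exists k, forall j, j <= size p ->
    e (nth x (x :: p) i) (nth x (x :: p) j) -> j = k.
  have [i0|i_pos] := posnP i; first by exists 1 => j jp /chp[]//; lia.
  by exists i.-1 => j jp /chp[]//; lia.
suff : degree e (path_vertices x p) y <= 1 by rewrite dy.
rewrite -(cardfs1 (nth x (x :: p) k)); apply: fsubset_leq_card.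
apply/fsubsetP=> z; rewrite !inE /= => /andP[zp]; rewrite yE.
have [j jp ->] : exists2 j, j <= size p & z = nth x (x :: p) j.
  by apply: memE; rewrite inE.
by move=> /nbr_k ->.
Qed.

Lemma handle_intro V x p : is_path e V x p -> chordless e x p ->
  (forall i, 0 < i < size p -> degree e V (nth x (x :: p) i) = 2) ->
  is_handle e V (size p) x p.
Proof. by move=> pathp chp deg2; split=> // y /(interior_nth chp)[i ? ->]; auto. Qed.

Lemma edge_handle V x y : x \in V -> y \in V -> e x y -> is_handle e V 1 x [:: y].
Proof.
move=> xV yV xy; apply: (@handle_intro V x [:: y]) => [||[|i]//].
  rewrite /is_path /= !inE xV yV xy /= !andbT.
  by apply: contraTneq xy => ->; rewrite e_irr.
by move=> [|[|i]] [|[|j]] //= _ _; rewrite ?e_irr; auto.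
Qed.

Lemma cherry_handle V x y z : triangle_free e V -> x \in V -> y \in V -> z \in V ->
  e x y -> e y z -> z != x -> degree e V y = 2 -> is_handle e V 2 x [:: y; z].
Proof.
move=> tfV xV yV zV xy yz zx dy.
have xz : e x z = false.
  by apply/negP => xz; apply: (tfV x y z) => //; split=> //; rewrite e_sym.
have neq a b : e a b -> a != b by apply: contraTneq => ->; rewrite e_irr.
apply: (@handle_intro V x [:: y; z]) => [||[|[|i]] //].
  by rewrite /is_path /= xV yV zV xy yz !inE negb_or (eq_sym x z) zx !neq.
by move=> [|[|[|i]]] [|[|[|j]]] //= _ _; rewrite ?e_irr ?xz ?(e_sym z x) ?xz; auto.
Qed.

Lemma other_neighbor V x y : 1 < degree e V y ->
  exists2 z, z != x & (z \in V) && e y z.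
Proof.
rewrite /degree (cardfsD1 x) => dy.
have /fset0Pn[z] : [fset w in V | e y w] `\ x != fset0.
  by rewrite -cardfs_gt0; move: dy; case: (x \in _); lia.
by rewrite !inE /= => /andP[zx zV]; exists z.
Qed.

(** The degree-2 neighbor [y] continues to a handle of length 2; the edge to the third neighbor is a
    handle of length 1, with empty interior. *)
Lemma fork_intro V x p y :
  triangle_free e V -> x \in V -> degree e V x = 3 ->
  y \in V -> e x y -> degree e V y = 2 -> y != head x p ->
  head x p \in V -> e x (head x p) ->
  fork e V 2 1 x p /\ fork e V 1 2 x p.
Proof.
move=> tfV xV dx yV xy dy yh hV xh.
have [z zx /andP[zV yz]] : exists2 z, z != x & (z \in V) && e y z.
  by apply: other_neighbor; rewrite dy.
have [z' z'h /andP[/andP[z'V xz'] z'y]] :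
    exists2 z', z' != head x p & (z' \in V) && e x z' && (z' != y).
  move: dx; rewrite /degree (cardfsD1 y) (cardfsD1 (head x p)) => dx.
  have /fset0Pn[w] : [fset w in V | e x w] `\ y `\ head x p != fset0.
    by rewrite -cardfs_gt0; move: dx; do 2!case: (_ \in _); lia.
  by rewrite !inE /= => /and4P[wh wy wV xw]; exists w; rewrite // wV xw.
have h2 : is_handle e V 2 x [:: y; z] by apply: cherry_handle.
have h1 : is_handle e V 1 x [:: z'] by apply: edge_handle.
split; split=> //; [exists [:: y; z], [:: z'] | exists [:: z'], [:: y; z]]; split=> //.
  by rewrite /= !inE negb_or eq_sym yh (eq_sym _ z') z'h eq_sym z'y.
by rewrite /= !inE negb_or (eq_sym _ y) yh (eq_sym _ z') z'h z'y.
Qed.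

(** The second vertex of the path qualifies. This makes the deletion of interiors terminate. *)
Lemma interior_neq0 V n x p : 1 < n -> is_handle e V n x p -> interior e x p != fset0.
Proof.
move=> n1 [/and3P[_ pathp uniqp] szp chp _]; subst n.
case: p n1 pathp uniqp chp => [|a [|b p]] //= _ /and3P[xa ab pathp] uniqp chp.
apply/fset0Pn; exists a; rewrite !inE eqxx orbT /=; apply/eqP.
rewrite /degree (_ : [fset y in _ | e a y] = [fset x; b]).
  by rewrite cardfs2; move: uniqp; rewrite !inE !negb_or => /andP[/and3P[_ ->]].
apply/fsetP => z; rewrite !inE; apply/andP/orP => [[zp az]|]; last first.
  by case=> /eqP ->; rewrite ?eqxx ?orbT // e_sym.
have [j jp zE] : exists2 j, j <= (size p).+2 & z = nth x [:: x, a, b & p] j.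
  exists (index z [:: x, a, b & p]); last by rewrite nth_index // !inE.
  by rewrite -ltnS -[(size p).+3]/(size [:: x, a, b & p]) index_mem !inE.
case: (chp 1 j) => //=; first by rewrite -zE.
  by move=> j2; right; rewrite zE j2.
by case=> j0; left; rewrite zE -j0.
Qed.

End Handles.

(** * The triangular lattice *)

(** In the basis [e1], [e2]: the rotation sends [e1] to [e2] and [e2] to [e2 - e1]. *)
Definition rot60 (u : lattice_point) : lattice_point := (- u.2, u.1 + u.2)%R.

Definition hex (i : nat) : lattice_point := iter i rot60 (1%R, 0%R).

Definition units : seq lattice_point := [seq hex i | i <- iota 0 6].

Definition origin : lattice_point := (0%R, 0%R).

(* The isometry that maps the origin to [r] and [hex 0] to [r + u]; its linear part is
   [frame origin u]. *)
Definition frame (r u a : lattice_point) : lattice_point :=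
  (r.1 + a.1 * u.1 + a.2 * (rot60 u).1, r.2 + a.1 * u.2 + a.2 * (rot60 u).2)%R.

Lemma frame_comp r u a v b :
  frame (frame r u a) (frame origin u v) b = frame r u (frame a v b).
Proof. by congr pair => /=; ring. Qed.

Lemma lin_comp u v b :
  frame origin (frame origin u v) b = frame origin u (frame origin v b).
Proof. by congr pair => /=; ring. Qed.

Lemma frame_origin r u : frame r u origin = r.
Proof. by case: r => r1 r2; congr pair => /=; ring. Qed.

Lemma unitsP (P : lattice_point -> Prop) :
  (forall i, i < 6 -> P (hex i)) -> {in units, forall u, P u}.
Proof. by move=> Phex u /mapP[i]; rewrite mem_iota => ? ->; apply: Phex. Qed.

(** In the Eisenstein integers, [frame r u] is multiplication by [u] followed by a translation;
    [sqdist] is the norm of the difference, which is multiplicative, and units have norm 1. *)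
Lemma adj_frame r u a b : u \in units ->
  lattice_adj (frame r u a) (frame r u b) = lattice_adj a b.
Proof.
move=> uU; rewrite /lattice_adj.
have -> : sqdist (frame r u a) (frame r u b) =
    (sqdist a b * (u.1 ^+ 2 + u.1 * u.2 + u.2 ^+ 2))%R.
  by rewrite /sqdist /=; ring.
have -> : (u.1 ^+ 2 + u.1 * u.2 + u.2 ^+ 2 = 1 :> int)%R.
  by move: u uU; apply: unitsP; case=> [|[|[|[|[|[|//]]]]]] _.
by rewrite mulr1.
Qed.

Lemma adj_sym : symmetric lattice_adj.
Proof.
move=> a b; rewrite /lattice_adj; suff -> : sqdist a b = sqdist b a by [].
by rewrite /sqdist; ring.
Qed.

Lemma adj_irr : irreflexive lattice_adj.
Proof. by move=> a; rewrite /lattice_adj /sqdist !subrr. Qed.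

Lemma frame_inj r u : u \in units -> injective (frame r u).
Proof.
move=> uU [a1 a2] [b1 b2].
move: u uU; apply: unitsP; case=> [|[|[|[|[|[|//]]]]]] _ [] /=; rewrite /= => E1 E2;
  congr pair; lia.
Qed.

(* The pair [(r, u)] stands for the vertex [r] with the direction [u], and [nb (r, u) i]
   is the neighbor of [r] in the direction [u] turned counterclockwise by [60 i] degrees. *)
Definition nb (d : lattice_point * lattice_point) (i : nat) : lattice_point :=
  frame d.1 d.2 (hex i).

Lemma hexD i j : i < 6 -> j < 6 -> frame origin (hex i) (hex j) = hex ((i + j) %% 6).
Proof. by move: i j; do 6?[case=> [|]//]; do 6?[case=> [|]//]. Qed.

Lemma hex_mod i : hex i = hex (i %% 6).
Proof.
rewrite {1}(divn_eq i 6) /hex addnC iterD; congr iter.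
elim: (i %/ 6) => // n IHn; rewrite mulSn iterD IHn.
by [].
Qed.

Lemma frame_hex0 r a : frame r (hex 0) a = (r.1 + a.1, r.2 + a.2)%R.
Proof. by congr pair => /=; ring. Qed.

Lemma lin_units u i : u \in units -> frame origin u (hex i) \in units.
Proof.
move=> uU; rewrite hex_mod.
have : i %% 6 < 6 by rewrite ltn_mod.
move: u uU (i %% 6); apply: unitsP => k k6 j j6.
by rewrite hexD // map_f // mem_iota ltn_mod.
Qed.

Lemma nb_lin r u i j : nb (r, frame origin u (hex i)) j = nb (r, u) (i + j).
Proof.
rewrite /nb -{1}(frame_origin r u) frame_comp /=; congr frame.
rewrite (hex_mod i) (hex_mod j) hexD ?ltn_mod // modnDm -hex_mod //.
Qed.

Lemma nb_mod d i : nb d i = nb d (i %% 6).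
Proof. by rewrite /nb -hex_mod. Qed.

Definition neighbors d : seq lattice_point := [seq nb d i | i <- iota 0 6].

Lemma neighbors_rot r u i : i < 6 ->
  neighbors (r, frame origin u (hex i)) = rot i (neighbors (r, u)).
Proof.
move=> i6; rewrite /neighbors -map_rot.
under eq_map do rewrite nb_lin nb_mod.
rewrite [RHS](_ : _ = [seq nb (r, u) j | j <- [seq (i + k) %% 6 | k <- iota 0 6]]).
  by rewrite -map_comp.
by congr map; move: i i6; do 6?[case=> [|]//].
Qed.

Lemma adjE r u a : u \in units -> lattice_adj r a = (a \in neighbors (r, u)).
Proof.
move=> uU; have -> : (a \in neighbors (r, u)) = (a \in neighbors (r, hex 0)).
  move: u uU; apply: unitsP => i i6.
  rewrite -(mem_rot i (neighbors (r, hex 0))) -neighbors_rot // hexD //.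
  by rewrite add0n modn_small.
rewrite /neighbors /=; case: r a => [r1 r2] [a1 a2].
rewrite /nb !frame_hex0 !inE /lattice_adj /sqdist /= !xpair_eqE.
set x := (r1 - a1)%R; set y := (r2 - a2)%R.
have -> : a1 = (r1 - x)%R by rewrite /x; ring.
have -> : a2 = (r2 - y)%R by rewrite /y; ring.
move: x y => x y; apply/eqP/idP => [E|]; last first.
  have eqs (p q : int) : x = p -> y = q ->
      (p ^+ 2 + p * q + q ^+ 2 = 1 -> x ^+ 2 + x * y + y ^+ 2 = 1)%R by move=> -> ->.
  do 5?[case/orP]; case/andP=> /eqP e1 /eqP e2.
  - by apply: (eqs (-1)%R 0%R); lia.
  - by apply: (eqs 0%R (-1)%R); lia.
  - by apply: (eqs 1%R (-1)%R); lia.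
  - by apply: (eqs 1%R 0%R); lia.
  - by apply: (eqs 0%R 1%R); lia.
  - by apply: (eqs (-1)%R 1%R); lia.
(* Since 4(x^2 + xy + y^2) = 3x^2 + (x + 2y)^2, the value 1 bounds x, and likewise y, by 1 in
   absolute value. *)
have bx : (x = -1 \/ x = 0 \/ x = 1 :> int)%R.
  have : (3 * (x * x) + (x + 2 * y) * (x + 2 * y) =
      4 * (x ^+ 2 + x * y + y ^+ 2) :> int)%R by ring.
  by rewrite E; nia.
have by' : (y = -1 \/ y = 0 \/ y = 1 :> int)%R.
  have : (3 * (y * y) + (y + 2 * x) * (y + 2 * x) =
      4 * (x ^+ 2 + x * y + y ^+ 2) :> int)%R by ring.
  by rewrite E; nia.
by case: bx E => [->|[->|->]]; case: by' => [->|[->|->]] // _; lia.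
Qed.

Lemma hex_inj i j : i < 6 -> j < 6 -> hex i = hex j -> i = j.
Proof. by move: i j; do 6?[case=> [|]//]; do 6?[case=> [|]//]. Qed.

Lemma neighbors_uniq r u : u \in units -> uniq (neighbors (r, u)).
Proof.
move=> uU; rewrite map_inj_in_uniq ?iota_uniq // => i j.
by rewrite !mem_iota => i6 j6 /(frame_inj uU)/hex_inj; apply.
Qed.

Implicit Types V S G : {fset lattice_point}.

Definition pattern V d : seq bool := [seq a \in V | a <- neighbors d].

Lemma pattern_rot V r u i : i < 6 ->
  pattern V (r, frame origin u (hex i)) = rot i (pattern V (r, u)).
Proof. by move=> i6; rewrite /pattern neighbors_rot // map_rot. Qed.

Lemma degree_pattern V r u : u \in units ->
  degree lattice_adj V r = count id (pattern V (r, u)).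
Proof.
move=> uU; rewrite /degree count_map -size_filter.
rewrite (_ : [fset y in V | _] = [fset y in [seq a <- neighbors (r, u) | a \in V]]).
  by rewrite card_fseq undup_id // filter_uniq // neighbors_uniq.
by apply/fsetP => y; rewrite in_fset [in RHS]in_fset mem_filter inE /= (adjE _ _ uU).
Qed.

Definition cyc_triangle_free (l : seq bool) : bool :=
  all (fun i => ~~ (nth false l i && nth false l (i.+1 %% 6))) (iota 0 6).

Lemma nth_pattern V d i : i < 6 -> nth false (pattern V d) i = (nb d i \in V).
Proof. by move: i; do 6?[case=> [|]//]. Qed.

Lemma nb_in V d i : (nb d i \in V) = nth false (pattern V d) (i %% 6).
Proof. by rewrite nth_pattern ?ltn_mod // -nb_mod. Qed.

Lemma adj_nb r u i : u \in units -> lattice_adj r (nb (r, u) i).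
Proof. by move=> uU; rewrite (adjE _ _ uU) nb_mod map_f // mem_iota ltn_mod. Qed.

Lemma adj_nbS r u i : u \in units -> lattice_adj (nb (r, u) i) (nb (r, u) i.+1).
Proof.
move=> uU; rewrite /nb adj_frame // /hex iterS -/(hex i) hex_mod.
have : i %% 6 < 6 by rewrite ltn_mod.
by case: (i %% 6); do 6?[case=> [|]//].
Qed.

Lemma pattern_triangle_free V r u : hexagonal V -> r \in V -> u \in units ->
  cyc_triangle_free (pattern V (r, u)).
Proof.
move=> hexV rV uU; apply/allP=> i; rewrite mem_iota => i6; apply/negP.
rewrite -nb_in nth_pattern // => /andP[iV jV].
apply: (hexV r _ _ rV iV jV); split; rewrite ?adj_nb ?adj_nbS //.
by rewrite adj_sym adj_nb.
Qed.

(** * Curvature *)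

(* The two leading bits describe the unit triangle [r], [nb d 0], [nb d 1], where [r] is
   in [S]: it counts +1 if [r] is its only vertex in [S].  A triangle with two vertices
   in [S] counts -1, but only at one of them. *)
Definition corner (l : seq bool) : int :=
  if nth false l 1 then 0%R else if nth false l 0 then (-1)%R else 1%R.

Definition charge (l : seq bool) : int :=
  foldr +%R 0%R [seq corner (rot i l) | i <- iota 0 6].

Definition run_end (l : seq bool) : bool := nth false l 0 && ~~ nth false l 1.

(** The number of maximal arcs of present neighbors, each counted at its last element; it is 0 both
    for no neighbor and for all six. *)
Definition runs (l : seq bool) : nat := count (fun i => run_end (rot i l)) (iota 0 6).

Lemma size6P (P : seq bool -> Prop) :
  (forall a b c d e f, P [:: a; b; c; d; e; f]) -> forall l, size l = 6 -> P l.
Proof. by move=> P6 [|a [|b [|c [|d [|e [|f [|]]]]]]]. Qed.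

Lemma charge_rot l i : size l = 6 -> i < 6 -> charge (rot i l) = charge l.
Proof.
move=> sz; move: l sz i; apply: size6P => a b c d e f i.
by move: i; do 6?[case=> [|]//=]; case: a b c d e f => [] [] [] [] [] [].
Qed.

Lemma size_pattern V d : size (pattern V d) = 6.
Proof. by []. Qed.

Definition vertex_charge S r : int := charge (pattern S (r, hex 0)).

Lemma vertex_chargeE S r u : u \in units -> vertex_charge S r = charge (pattern S (r, u)).
Proof.
move: u; apply: unitsP => i i6.
have -> : hex i = frame origin (hex 0) (hex i) by rewrite hexD // add0n modn_small.
by rewrite pattern_rot // charge_rot.
Qed.

(** This is t1 - t2, where ti counts the unit triangles with exactly i vertices in [S]. As 6V = t1 +
    2 t2 + 3 t3, 2E = t2 + 3 t3 and F = t3, it equals 6(V - E + F). *)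
Definition curvature S : int := (\sum_(r <- S) vertex_charge S r)%R.

Lemma pattern_rem V v d : v \notin neighbors d -> pattern (V `\ v) d = pattern V d.
Proof.
move=> vd; apply/eq_in_map => a ad; rewrite !inE.
by case: eqP ad vd => // -> ->.
Qed.

Lemma vertex_charge_rem S v r : ~~ lattice_adj r v ->
  vertex_charge (S `\ v) r = vertex_charge S r.
Proof. by move=> rv; rewrite /vertex_charge pattern_rem // -adjE. Qed.

(** At a neighbor of a removed vertex two triangles change: the first term is for the one shared
    with the next neighbor around that vertex, the second for the one shared with the previous
    neighbor. *)
Definition corner_change (next prev : bool) : int :=
  ((if next then -1 else 1) + (if prev then 0 else 2))%R.

Lemma vertex_charge_rem_nb S v w : v \in S -> w \in units ->
  (vertex_charge (S `\ v) (nb (v, w) 0) = vertex_charge S (nb (v, w) 0) +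
   corner_change (nb (v, w) 1 \in S) (nb (v, w) 5 \in S))%R.
Proof.
(* The direction [u] at [r] points back to [v]. *)
move=> vS wU; set r := nb (v, w) 0; set u := frame origin w (hex 3).
have uU : u \in units by apply: lin_units.
rewrite !(@vertex_chargeE _ _ u) //.
have nbE i : nb (r, u) i = frame v w (frame (hex 0) (hex 3) (hex i)).
  by rewrite -frame_comp.
have nv i : 0 < i < 6 -> nb (r, u) i != v.
  rewrite nbE -[v in _ != v](frame_origin v w) (inj_eq (frame_inj wU)).
  by move: i; do 6?[case=> [|]//].
have pE V : pattern V (r, u) = [:: nb (r, u) 0 \in V; nb (r, u) 1 \in V; nb (r, u) 2 \in V;
    nb (r, u) 3 \in V; nb (r, u) 4 \in V; nb (r, u) 5 \in V] by [].
rewrite !pE !in_fsetD1 (nv 1) // (nv 2) // (nv 3) // (nv 4) // (nv 5) //.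
have -> : nb (r, u) 0 = v by rewrite nbE -[RHS](frame_origin v w).
have -> : nb (r, u) 1 = nb (v, w) 5 by rewrite nbE.
have -> : nb (r, u) 5 = nb (v, w) 1 by rewrite nbE.
rewrite eqxx vS /=.
by do 5!case: (_ \in S).
Qed.

Lemma run_count l : size l = 6 ->
  (\sum_(i <- iota 0 6 | nth false l i)
     corner_change (nth false l (i.+1 %% 6)) (nth false l ((i + 5) %% 6)) - charge l =
  6 * ((runs l)%:Z - 1))%R.
Proof.
move: l; apply: size6P => a b c d e f; rewrite unlock.
by case: a b c d e f => [] [] [] [] [] [].
Qed.

Lemma big_seq_supp (F : lattice_point -> int) (s t : seq lattice_point) :
  uniq s -> uniq t -> (forall r, r \in s -> r \notin t -> F r = 0%R) ->
  (\sum_(r <- s) F r = \sum_(r <- t | r \in s) F r)%R.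
Proof.
move=> us ut F0; rewrite (bigID (mem t)) /= [X in (_ + X)%R]big_seq_cond.
rewrite [X in (_ + X)%R]big1 ?addr0 => [|r /andP[]]; last exact: F0.
rewrite -big_filter -[RHS]big_filter; apply: perm_big.
by apply: uniq_perm; rewrite ?filter_uniq // => r; rewrite !mem_filter andbC.
Qed.

(** Removing a vertex changes the Euler characteristic by that of its link minus 1; the link is part
    of a hexagon and has Euler characteristic [runs]. Only charges at [v] and its neighbors are
    affected. *)
Lemma curvature_rem S v : v \in S ->
  (curvature (S `\ v) = curvature S + 6 * ((runs (pattern S (v, hex 0)))%:Z - 1))%R.
Proof.
move=> vS; rewrite -run_count // /curvature (big_fsetD1 v vS) /= -/(vertex_charge S v).
have hU : hex 0 \in units by [].
suff : (\sum_(r <- S `\ v) (vertex_charge (S `\ v) r - vertex_charge S r) =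
  \sum_(i <- iota 0 6 | nth false (pattern S (v, hex 0)) i)
     corner_change (nth false (pattern S (v, hex 0)) (i.+1 %% 6))
       (nth false (pattern S (v, hex 0)) ((i + 5) %% 6)))%R.
  by rewrite sumrB => /eqP; rewrite subr_eq => /eqP ->; ring.
rewrite (@big_seq_supp _ _ (neighbors (v, hex 0))) ?fset_uniq ?neighbors_uniq //.
  rewrite /neighbors big_map big_seq_cond [RHS]big_seq_cond; apply: eq_big => [i|i].
    rewrite mem_iota; case: (ltnP i 6) => //= i6; rewrite nth_pattern // !inE.
    case: eqP => // iv; have := adj_nb v i hU; rewrite iv adj_irr //.
  rewrite mem_iota => /andP[i6 _]; rewrite -!nb_in.
  have nbi j : nb (v, hex 0) (i + j) = nb (v, frame origin (hex 0) (hex i)) j.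
    by rewrite nb_lin.
  rewrite -[in nb _ i](addn0 i) -addn1 !nbi vertex_charge_rem_nb ?lin_units //.
  by rewrite addrAC subrr add0r.
move=> r _; rewrite -adjE // => rv.
by rewrite vertex_charge_rem ?subrr // adj_sym.
Qed.

(** * Filling the holes *)

Lemma runs_rot l i : size l = 6 -> i < 6 -> runs (rot i l) = runs l.
Proof.
move=> sz; move: l sz i; apply: size6P => a b c d e f i.
by move: i; do 6?[case=> [|]//=]; case: a b c d e f => [] [] [] [] [] [].
Qed.

Lemma run_end_rot l i : size l = 6 -> i < 6 ->
  run_end (rot i l) = nth false l i && ~~ nth false l (i.+1 %% 6).
Proof.
move=> sz; move: l sz i; apply: size6P => a b c d e f i.
by move: i; do 6?[case=> [|]//=].
Qed.

Lemma runs_pattern S r u : u \in units ->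
  runs (pattern S (r, u)) = runs (pattern S (r, hex 0)).
Proof.
move: u; apply: unitsP => i i6.
have -> : hex i = frame origin (hex 0) (hex i) by rewrite hexD // add0n modn_small.
by rewrite pattern_rot // runs_rot.
Qed.

Definition locally_constant S (f : lattice_point -> nat) : Prop :=
  forall a b, a \in S -> b \in S -> lattice_adj a b -> f a = f b.

(* Stated through locally constant functions, this says that the Euler characteristic is
   at least the number of connected components. *)
Definition hole_free S : Prop :=
  forall f, locally_constant S f -> ((6 * #|` f @` S|)%:Z <= curvature S)%R.

(** A locally constant function has one value on each run; as [nb (v, u) 0] is absent, no run passes
    from index 5 to 0. *)
Lemma card_neighbor_values S v u f : u \in units -> nb (v, u) 0 \notin S ->
  locally_constant (S `\ v) f ->
  #|` f @` [fset a in S | lattice_adj v a]| <= runs (pattern S (v, u)).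
Proof.
move=> uU out0 fS; set t := pattern S (v, u).
set K := [seq i <- iota 0 6 | run_end (rot i t)].
have nbv i : nb (v, u) i != v.
  by apply: contraTneq (adj_nb v i uU) => ->; rewrite adj_irr.
have run i n : i + n = 5 -> nb (v, u) i \in S ->
    exists2 k, k \in K & f (nb (v, u) i) = f (nb (v, u) k).
  elim: n i => [|n IHn] i i5 iS.
    exists i => //; rewrite mem_filter mem_iota run_end_rot //; last by lia.
    have -> : i = 5 by lia.
    by rewrite !nth_pattern // out0 -[5](_ : i = 5) ?iS //; lia.
  case iS1 : (nb (v, u) i.+1 \in S); last first.
    exists i => //; rewrite mem_filter mem_iota run_end_rot //; last by lia.
    by rewrite modn_small ?nth_pattern ?iS ?iS1 //=; lia.
  have [|//|k kK ik] := IHn i.+1; first by lia.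
  by exists k; rewrite // -ik; apply: fS; rewrite ?inE ?nbv ?adj_nbS.
have -> : runs t = size K by rewrite size_filter.
rewrite -(size_map (fun k => f (nb (v, u) k))).
apply: leq_trans (size_undup _); rewrite -card_fseq; apply: fsubset_leq_card.
apply/fsubsetP => x /imfsetP[a /=]; rewrite !inE (adjE _ _ uU) => /andP[aS].
case/mapP=> i; rewrite mem_iota => i6 ai ->; subst a.
have [||k kK ->] := run i (5 - i) => //; first by lia.
exact: (map_f (fun k => f (nb (v, u) k))) kK.
Qed.

(* Merging the values that [f] takes around [v] makes it locally constant on [S]. *)
Lemma hole_free_rem S v u : v \in S -> u \in units -> nb (v, u) 0 \notin S ->
  hole_free S -> hole_free (S `\ v).
Proof.
move=> vS uU out0 hS f fS; rewrite curvature_rem // -(runs_pattern _ _ uU).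
have := card_neighbor_values uU out0 fS.
set N := [fset a in S | _]; set A := f @` (S `\ v).
have NP a : (a \in N) = (a \in S) && lattice_adj v a by rewrite !inE.
have [N0|/fset0Pn[a0 a0N]] := eqVneq N fset0.
  (* If [v] is isolated, it receives a value larger than all others, so [f] extends to [S] with one
     more value. *)
  pose m := (\sum_(x <- A) x).+1.
  have mA : m \notin A.
    apply/negP => mA; have : m <= \sum_(x <- A) x by rewrite (big_fsetD1 m mA) /= leq_addr.
    by rewrite ltnn.
  have noN a : a \in S -> lattice_adj v a -> False.
    by move=> aS va; have := NP a; rewrite N0 inE aS va.
  pose g a := if a == v then m else f a.
  have gS : locally_constant S g.
    move=> a b aS bS ab; rewrite /g; case: eqP => [av|/eqP av].
      by case: (noN b) => //; rewrite -av.
    case: eqP => [bv|/eqP bv]; first by case: (noN a) => //; rewrite -bv adj_sym.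
    by apply: fS; rewrite ?inE ?av ?bv.
  have : #|` A| < #|` g @` S|.
    have -> : #|` A|.+1 = #|` m |` A| by rewrite cardfsU1 mA.
    apply: fsubset_leq_card; apply/fsubsetP => x; rewrite !inE => /orP[/eqP ->|].
      by apply/imfsetP; exists v; rewrite //= /g eqxx.
    case/imfsetP=> a /=; rewrite !inE => /andP[av aS] ->.
    by apply/imfsetP; exists a; rewrite //= /g (negPf av).
  have := hS g gS; lia.
(* Otherwise all values around [v] are merged into [x0], which loses at most |X| - 1 <= [runs] - 1
   values. *)
pose X := f @` N; pose x0 := f a0.
have x0X : x0 \in X by apply: in_imfset.
pose g a := if (a == v) || (f a \in X) then x0 else f a.
have fX a : a \in N -> f a \in X by move=> aN; apply: in_imfset.
have gS : locally_constant S g.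
  move=> a b aS bS ab; rewrite /g; case: (eqVneq a v) ab => [-> vb|av ab] /=.
    by rewrite fX ?orbT // NP bS.
  case: (eqVneq b v) ab => [-> va|bv ab] /=; first by rewrite fX // NP aS adj_sym.
  by rewrite (fS a b) ?inE ?av ?bv.
have x0g : x0 \in g @` S by apply/imfsetP; exists v; rewrite //= /g eqxx.
have sub : A `<=` (g @` S `\ x0) `|` X.
  apply/fsubsetP => x /imfsetP[a /=]; rewrite !inE => /andP[av aS] ->.
  case aX : (f a \in X); rewrite ?orbT // orbF.
  rewrite (contraFneq _ aX) => [|->//] /=.
  by apply/imfsetP; exists a; rewrite //= /g (negPf av) aX.
have := fsubset_leq_card sub; rewrite cardfsU => subc.
have := hS g gS; rewrite (cardfsD1 x0 (g @` S)) x0g /= -/X => hg Xruns.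
have : #|` A| <= #|` g @` S `\ x0| + #|` X| by apply: leq_trans subc _; rewrite leq_subr.
move: hg Xruns {subc}; move: #|` A| #|` X| #|` g @` S `\ x0| (curvature S) (runs _); lia.
Qed.

Lemma pattern_add S v u : u \in units -> pattern (v |` S) (v, u) = pattern S (v, u).
Proof.
move=> uU; apply/eq_in_map => a; rewrite -adjE // !inE.
by case: eqP => // ->; rewrite adj_irr.
Qed.

Lemma curvature_add S v u : u \in units -> v \notin S ->
  (curvature (v |` S) = curvature S - 6 * ((runs (pattern S (v, u)))%:Z - 1))%R.
Proof.
move=> uU vS; have := @curvature_rem (v |` S) v; rewrite -(runs_pattern _ _ uU) pattern_add //.
by rewrite fsetU1K // fset1U1 => ->//; ring.
Qed.

Lemma hole_free1 v : hole_free [fset v].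
Proof.
move=> f _; rewrite imfset_fset1 cardfs1.
rewrite -[[fset v]]fsetU0 (@curvature_add _ _ (hex 0)) ?inE //.
by rewrite /pattern /= !inE /curvature big_nil.
Qed.

(** A single run leaves the Euler characteristic unchanged, and [v] shares its value with a
    neighbor. *)
Lemma hole_free_add S v u : u \in units -> v \notin S ->
  runs (pattern S (v, u)) = 1 -> hole_free S -> hole_free (v |` S).
Proof.
move=> uU vS run1 hS f fS; rewrite (curvature_add uU) // run1 subrr mulr0 subr0.
have [a aS va] : exists2 a, a \in S & lattice_adj v a.
  have : has id (pattern S (v, u)).
    move: run1; move: (pattern S _) (size_pattern S (v, u)).
    by apply: size6P => -[] [] [] [] [] [].
  by rewrite has_map => /hasP[a]; rewrite -adjE //; exists a.
have -> : f @` (v |` S) = f @` S.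
  apply/fsetP => x; apply/imfsetP/imfsetP => -[b /= bS ->]; last first.
    by exists b; rewrite // inE bS orbT.
  move: bS; rewrite !inE => /orP[/eqP ->|bS]; last by exists b.
  by exists a => //; apply: fS; rewrite ?inE ?eqxx ?aS ?orbT.
by apply: hS => b c bS cS; apply: fS; rewrite inE ?bS ?cS orbT.
Qed.

(* The parallelogram is filled row by row; [n] rows are complete and the next one
   contains [m] points. *)
Definition staircase (N n m : nat) (a : lattice_point) : bool :=
  [&& (- N%:Z <= a.1), (a.1 <= N%:Z), (- N%:Z <= a.2) &
      (a.2 + N%:Z < n%:Z) || ((a.2 + N%:Z == n%:Z) && (a.1 + N%:Z < m%:Z))]%R.

Lemma hole_free_staircase N n m : m <= N.*2.+1 -> 0 < n + m ->
  exists2 S, hole_free S & forall a, (a \in S) = staircase N n m a.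
Proof.
elim: n m => [|n IHn] m mN; elim: m mN => [|m IHm] mN // _.
- case: m mN IHm => [|m] mN IHm.
    exists [fset ((- N%:Z)%R, (- N%:Z)%R)]; first exact: hole_free1.
    by move=> [a b]; rewrite !inE xpair_eqE /staircase /=; lia.
  have [||S hS SE] := IHm; [lia|lia|].
  exists ((m.+1%:Z - N%:Z, - N%:Z)%R |` S).
    apply: (@hole_free_add _ _ (hex 0)) => //; first by rewrite SE /staircase /=; lia.
    rewrite /pattern /= /nb !frame_hex0 !SE /staircase /=.
    rewrite [X in runs X](_ : _ = [:: false; false; false; true; false; false]) //.
    by congr [:: _; _; _; _; _; _]; lia.
  by move=> [a b]; rewrite !inE SE xpair_eqE /staircase /=; lia.
- have [||S hS SE] := IHn N.*2.+1; [lia|lia|].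
  by exists S => // a; rewrite SE /staircase; lia.
have [||S hS SE] := IHm; [lia|lia|].
exists ((m%:Z - N%:Z, n.+1%:Z - N%:Z)%R |` S).
  apply: (@hole_free_add _ _ (hex 0)) => //; first by rewrite SE /staircase /=; lia.
  rewrite /pattern /= /nb !frame_hex0 !SE /staircase /=.
  (* The left neighbor is missing at the start of a row, the lower right one at its end; the lower
     left one is always present, so there is one run. *)
  rewrite [X in runs X](_ : _ = [:: false; false; false; 0 < m; true; m < N.*2]).
    by case: (0 < m); case: (m < N.*2).
  by congr [:: _; _; _; _; _; _]; lia.
by move=> [a b]; rewrite !inE SE xpair_eqE /staircase /=; lia.
Qed.

Lemma hole_free_superset G : exists2 S, hole_free S & G `<=` S.
Proof.
pose N := \sum_(a <- G) (absz a.1 + absz a.2).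
have [||S hS SE] := @hole_free_staircase N N.*2.+1 0; [lia|lia|].
exists S => //; apply/fsubsetP => a aG; rewrite SE /staircase.
have : absz a.1 + absz a.2 <= N by rewrite /N (big_fsetD1 a aG) /= leq_addr.
lia.
Qed.

(** Starting from a large parallelogram, a point outside [G] with an absent neighbor is deleted as
    long as there is one; [hole_free_rem] applies each time. *)
Lemma hole_free_filling G : exists S, [/\ hole_free S, G `<=` S &
  forall a b, a \in S -> lattice_adj a b -> b \notin S -> a \in G].
Proof.
have [S0 hS0 GS0] := hole_free_superset G.
have [n] := ubnP #|` S0|; elim: n S0 hS0 GS0 => // n IHn S hS GS cS.
have [fin|/allPn[a aS]] := boolP (all (fun a =>
    (a \in G) || all (mem S) (neighbors (a, hex 0))) S).
  exists S; split=> // a b aS ab bS; have := allP fin a aS.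
  by case/orP=> // /allP/(_ b); rewrite -adjE // => /(_ ab) /= bS'; rewrite bS' in bS.
rewrite negb_or => /andP[aG].
case/allPn => b /mapP[i]; rewrite mem_iota => i6 -> outb.
apply: (IHn (S `\ a)).
- have hU : hex i \in units by apply: map_f; rewrite mem_iota.
  apply: (hole_free_rem aS hU) => //.
  rewrite -[hex i](_ : frame origin (hex 0) (hex i) = _) ?nb_lin ?addn0 //.
  by rewrite hexD // modn_small.
- by rewrite fsubsetD1 GS.
- by move: cS; rewrite (cardfsD1 a S) aS; lia.
Qed.

Lemma hole_free_curvature_gt0 S a : hole_free S -> a \in S -> (0 < curvature S)%R.
Proof.
move=> hS aS; have := hS (fun _ => 0) (fun _ _ _ _ _ => erefl).
suff : 0 < #|` (fun _ => 0) @` S| by lia.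
by rewrite cardfs_gt0; apply/fset0Pn; exists 0; apply/imfsetP; exists a.
Qed.

(** * The boundary walk *)

Notation dart := (lattice_point * lattice_point)%type.

(* The boundary walk arrives at [d.1] from [nb d 0], has the complement of [S] at [nb d 1]
   and leaves through [nb d (exit c)].  [Branch] is the right turn of degree 3. *)
Variant symbol := Convex | Straight | Concave | Branch.

Definition code (c : symbol) : seq bool :=
  match c with
  | Convex => [:: true; false; false; false; true; false]
  | Straight => [:: true; false; false; true; false; false]
  | Concave => [:: true; false; true; false; false; false]
  | Branch => [:: true; false; true; false; true; false]
  end.

Definition exit (c : symbol) : nat :=
  match c with Convex => 4 | Straight => 3 | _ => 2 end.

Lemma exit_code c : nth false (code c) (exit c) = true.
Proof. by case: c. Qed.

Lemma exit_gt0 c : 0 < exit c.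
Proof. by case: c. Qed.

Lemma exit_lt c : exit c < 6.
Proof. by case: c. Qed.

Definition turning (c : symbol) : int := ((exit c)%:Z - 3)%R.

(** The new direction points back to the vertex just left, hence the half turn [+ 3]. *)
Definition step (d : dart) (c : symbol) : dart :=
  (nb d (exit c), frame origin d.2 (hex (exit c + 3))).

Lemma nb_step d c i :
  nb (step d c) i = frame d.1 d.2 (frame (hex (exit c)) (hex (exit c + 3)) (hex i)).
Proof. by rewrite -frame_comp. Qed.

Lemma nb_step0 d c : nb (step d c) 0 = d.1.
Proof. by rewrite nb_step -[RHS](frame_origin d.1 d.2); case: c. Qed.

Lemma nb_step1 d c : nb (step d c) 1 = nb d (exit c).-1.
Proof. by rewrite nb_step; case: c. Qed.

(** The rotation by [9 - exit c] undoes the one by [exit c + 3]: the sum is two full turns. *)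
Lemma stepK d c : d.2 = frame origin (step d c).2 (hex (9 - exit c)).
Proof.
rewrite -[origin in RHS](frame_origin origin d.2) frame_comp; case: d => r [u1 u2].
by case: c; congr pair => /=; ring.
Qed.

Definition symbol_of_code (g : seq bool) : symbol :=
  if nth false g 4 then if nth false g 2 then Branch else Convex
  else if nth false g 3 then Straight else Concave.

Definition symbol_at V (d : dart) : symbol := symbol_of_code (pattern V d).

(** On a pattern with only bit 0 set the value is 6: the walk turns back. *)
Definition first_exit (l : seq bool) : nat := (find id (behead l)).+1.

(** Between a run end at 0 and the next present neighbor k, one triangle counts -1 and k - 2 count
    +1, in total k - 3. *)
Lemma charge_runs l : size l = 6 -> has id l ->
  charge l = (\sum_(i <- iota 0 6 | run_end (rot i l)) ((first_exit (rot i l))%:Z - 3))%R.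
Proof.
move=> sz; move: l sz; apply: size6P => a b c d e f; rewrite unlock.
by case: a b c d e f => [] [] [] [] [] [].
Qed.

Definition boundary_compatible (s g : seq bool) : bool :=
  all (fun i => (nth false g i ==> nth false s i) &&
    (nth false s i && ~~ (nth false s (i.+1 %% 6) && nth false s ((i + 5) %% 6))
       ==> nth false g i)) (iota 0 6).

(** Neighbor 0 lies in the graph, so 1 and 5 do not; the graph has a nonempty set without
    consecutive elements among 2, 3, 4, which leaves the four codes. The first neighbor in the
    filled set after the gap is on the boundary, hence in the graph: it is the exit. *)
Lemma boundary_code s g : size s = 6 -> size g = 6 -> boundary_compatible s g ->
  cyc_triangle_free g -> 1 < count id g -> run_end s ->
  let c := symbol_of_code g in
  [/\ g = code c, first_exit s = exit c & take (exit c) s = true :: nseq (exit c).-1 false].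
Proof.
move=> szs szg; move: s szs; apply: size6P => a b c d e f.
case: a; case: b; rewrite ?andbF //.
move: g szg; apply: size6P => a' b' c' d' e' f'.
by case: c d e f => [] [] [] []; case: a' b' c' d' e' f' => [] [] [] [] [] [].
Qed.

Section Boundary.
Variables G S : {fset lattice_point}.
Hypotheses (hexG : hexagonal G) (degG : forall a, a \in G -> 1 < degree lattice_adj G a).
Hypotheses (GS : G `<=` S)
  (GbdS : forall a b, a \in S -> lattice_adj a b -> b \notin S -> a \in G).

Definition is_dart (d : dart) : bool :=
  [&& d.1 \in S, d.2 \in units & run_end (pattern S d)].

Notation symb := (symbol_at G).

Definition advance (d : dart) : dart := step d (symb d).

Lemma dart_pattern d : is_dart d ->
  [/\ d.1 \in G, pattern G d = code (symb d),
      first_exit (pattern S d) = exit (symb d) &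
      forall i, 0 < i < exit (symb d) -> nb d i \notin S].
Proof.
case: d => r u /and3P[/= rS uU run].
have symbE : symb (r, u) = symbol_of_code (pattern G (r, u)) by [].
have out1 : nb (r, u) 1 \notin S by move/andP: run => [_]; rewrite nth_pattern.
have rG : r \in G by apply: GbdS out1; rewrite ?adj_nb.
have := @boundary_code (pattern S (r, u)) (pattern G (r, u)).
case=> //; rewrite -?symbE.
- apply/allP=> i; rewrite mem_iota => /= i6; rewrite -!nb_in !nth_pattern //.
  apply/andP; split; first by apply/implyP=> /(fsubsetP GS).
  apply/implyP=> /andP[iS]; rewrite negb_and => /orP[] out.
    by apply: GbdS out; rewrite // adj_nbS.
  apply: GbdS out; rewrite // adj_sym.
  have -> : nb (r, u) i = nb (r, u) (i + 5).+1 by rewrite nb_mod [RHS]nb_mod -addnS modnDr.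
  exact: adj_nbS.
- exact: pattern_triangle_free.
- by rewrite -degree_pattern // degG.
move=> gE fE takeE; split=> // i /andP[i0 ic]; rewrite -nth_pattern.
  by rewrite -(nth_take _ ic) takeE; case: i i0 ic => // i _ ic; rewrite /= nth_nseq if_same.
exact: ltn_trans ic (exit_lt _).
Qed.

Lemma advance_dart d : is_dart d -> is_dart (advance d).
Proof.
move=> dd; have [dG gE _ out] := dart_pattern dd.
case/and3P: (dd) => dS uU _; apply/and3P; split.
- apply: (fsubsetP GS).
  by rewrite -nth_pattern ?exit_lt // gE exit_code.
- exact: lin_units.
rewrite /run_end !nth_pattern // nb_step0 nb_step1 dS out //=.
by case: (symb d).
Qed.

(** Darts with the same image sit at the same vertex. If their exits differed, the neighbor through
    which one arrives, in [S], would lie in the gap swept by the other, outside [S]. *)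
Lemma advance_inj : {in is_dart &, injective advance}.
Proof.
suff wlog_inj d1 d2 : is_dart d1 -> is_dart d2 -> exit (symb d1) <= exit (symb d2) ->
    advance d1 = advance d2 -> d1 = d2.
  move=> d1 d2 D1 D2 E; case/orP: (leq_total (exit (symb d1)) (exit (symb d2))) => le12.
    exact: wlog_inj.
  by apply/esym/wlog_inj.
move=> D1 D2 le12 E.
have r12 : d1.1 = d2.1.
  by rewrite -(nb_step0 d1 (symb d1)) -(nb_step0 d2 (symb d2)) -/(advance _) E.
have u1 := stepK d1 (symb d1); have u2 := stepK d2 (symb d2).
rewrite -/(advance _) in u1 u2.
move: le12; rewrite leq_eqVlt => /orP[/eqP e12|lt12].
  by rewrite (surjective_pairing d1) (surjective_pairing d2) r12 u1 u2 E e12.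
have [_ _ _ out2] := dart_pattern D2.
have /and3P[_ _ /andP[in1 _]] := D1; rewrite nth_pattern // in in1.
have /negP[] : nb d2 (exit (symb d2) - exit (symb d1)) \notin S.
  by apply: out2; move: (exit_gt0 (symb d1)) lt12; lia.
have nbE d i : nb d i = nb (d.1, (advance d).2) (9 - exit (symb d) + i).
  by rewrite -nb_lin /advance -stepK -surjective_pairing.
have -> : nb d2 (exit (symb d2) - exit (symb d1)) = nb d1 0 => //.
rewrite nbE [RHS]nbE E r12; congr nb; move: lt12 (exit_lt (symb d2)); lia.
Qed.

Definition darts : seq dart := [seq d <- [seq (r, u) | r <- S, u <- units] | is_dart d].

Lemma mem_darts d : (d \in darts) = is_dart d.
Proof.
rewrite mem_filter; case D : (is_dart d) => //; rewrite andTb; apply/allpairsP; exists d.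
by case/and3P: D => -> -> _; split; rewrite -?surjective_pairing.
Qed.

Lemma darts_uniq : uniq darts.
Proof. by apply/filter_uniq/allpairs_uniq => [||[? ?] [? ?] _ _] //; apply: fset_uniq. Qed.

Lemma sum_advance (h : dart -> int) :
  (\sum_(d <- darts) h (advance d) = \sum_(d <- darts) h d)%R.
Proof.
rewrite -(big_map advance predT); apply: perm_big.
have um : uniq (map advance darts).
  rewrite map_inj_in_uniq ?darts_uniq // => d1 d2.
  by rewrite !mem_darts; apply: advance_inj.
have sub : {subset map advance darts <= darts}.
  by move=> _ /mapP[d + ->]; rewrite !mem_darts; apply: advance_dart.
apply: uniq_perm; rewrite ?darts_uniq //.
by have [] := uniq_min_size um sub; rewrite ?size_map.
Qed.

Lemma curvature_darts : curvature S = (\sum_(d <- darts) turning (symb d))%R.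
Proof.
rewrite /darts big_filter big_mkcond big_allpairs /curvature /=.
rewrite big_seq [RHS]big_seq; apply: eq_bigr => r rS; rewrite -big_mkcond /=.
(* A vertex without neighbors in [S] would be on the boundary, hence in [G], where it has
   neighbors. *)
rewrite /vertex_charge charge_runs //; last first.
  have hU : hex 0 \in units by [].
  apply: contraT => /hasPn noS.
  have outS i : i < 6 -> nb (r, hex 0) i \notin S.
    by move=> i6; apply: noS; do 2!apply: map_f; rewrite mem_iota.
  have rG : r \in G by apply: GbdS (outS 0 isT); rewrite ?adj_nb.
  have /(other_neighbor r)[a _ /andP[aG]] := degG rG.
  rewrite (adjE _ _ hU) => /mapP[i]; rewrite mem_iota => i6 ai.
  by have := outS i i6; rewrite -ai (fsubsetP GS).
rewrite /units big_map big_seq_cond [RHS]big_seq_cond.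
have rotE i : i < 6 -> rot i (pattern S (r, hex 0)) = pattern S (r, hex i).
  move=> i6; rewrite -pattern_rot // hexD // modn_small //.
apply: eq_big => [i|i]; rewrite mem_iota; case: (ltnP i 6) => //= i6; rewrite rotE //.
  by rewrite /is_dart /= rS map_f ?mem_iota.
move=> run; have dd : is_dart (r, hex i) by rewrite /is_dart /= rS map_f ?mem_iota.
by have [_ _ -> _] := dart_pattern dd.
Qed.

End Boundary.

(** * Discharging along the boundary walk *)

Definition is_branch (c : symbol) : bool := if c is Branch then true else false.

Fixpoint block_sum (w : seq symbol) : int :=
  if w is c :: w' then (turning c + block_sum w')%R else 0%R.

Section Discharging.
Variables G S : {fset lattice_point}.
Hypotheses (hexG : hexagonal G) (degG : forall a, a \in G -> 1 < degree lattice_adj G a).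
Hypotheses (GS : G `<=` S)
  (GbdS : forall a b, a \in S -> lattice_adj a b -> b \notin S -> a \in G).

Notation nxt := (advance G).
Notation branch d := (is_branch (symbol_at G d)).

Fixpoint word (n : nat) (d : dart) : seq symbol :=
  if n is n'.+1 then symbol_at G d :: word n' (nxt d) else [::].

(** [n] is fuel: the block is complete once [word n d] contains a [Branch]. *)
Fixpoint block (n : nat) (d : dart) : seq symbol :=
  if n is n'.+1 then
    if branch d then [::] else symbol_at G d :: block n' (nxt d)
  else [::].

Lemma block_stable n d : has is_branch (word n d) -> block n.+1 d = block n d.
Proof.
elim: n d => //= n IHn d; case: (branch d) => //= hasb.
by congr cons; apply: IHn.
Qed.

Lemma word_block n d : has is_branch (word n d) -> let w := block n d in
  [/\ size w < n, ~~ has is_branch w & word (size w).+1 d = rcons w Branch].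
Proof.
elim: n d => //= n IHn d; case: (symbol_at G d) => //= /IHn[? ? wE]; split=> //;
  by rewrite -wE.
Qed.

(* With [h d] the sum of the turns from [d] to the next branch vertex, the charge
   [turning + h (nxt d) - h d] is concentrated on branch vertices, where it is the sum of
   the following block minus 1.  A block of sum 2 must be preceded by a block of length
   0, whose charge -1 compensates; [h2] performs this transfer. *)
Lemma discharge N : 0 < N ->
  (forall d, is_dart S d -> has is_branch (word N d)) ->
  (forall d, is_dart S d -> branch d -> (block_sum (block N (nxt d)) <= 2)%R) ->
  (forall d, is_dart S d -> ~~ branch d -> branch (nxt d) ->
     block_sum (block N (nxt (nxt d))) <> 2%R) ->
  (curvature S <= 0)%R.
Proof.
move=> N0 hasb smallA smallB; rewrite (curvature_darts hexG degG GS GbdS).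
pose h d := block_sum (block N d).
pose h2 d : int := (if branch d && (h (nxt d) == 2%R) then 1 else 0)%R.
pose H d := (h d + h2 d)%R.
(* The added terms cancel because [nxt] permutes the darts. *)
have -> : (\sum_(d <- darts S) turning (symbol_at G d) =
    \sum_(d <- darts S) (turning (symbol_at G d) + (H (nxt d) - H d)))%R.
  rewrite [RHS]big_split /= [X in (_ + X)%R]sumrB.
  by rewrite (sum_advance hexG degG GS GbdS H) subrr addr0.
rewrite big_seq; apply: sumr_le0 => d; rewrite mem_darts /H => dd.
have hS : ~~ branch d -> h d = (turning (symbol_at G d) + h (nxt d))%R.
  have := hasb d dd; rewrite /h; case: N N0 {hasb smallA smallB h h2 H} => // n _ /=.
  case: (branch d) => //= hb _; congr (_ + block_sum _)%R.
  exact/esym/block_stable.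
have h0 d' : branch d' -> h d' = 0%R.
  by rewrite /h; case: N N0 {hasb smallA smallB h h2 H hS} => //= n _ ->.
case: (boolP (branch d)) => bd.
  have -> : turning (symbol_at G d) = (-1)%R by move: bd; case: (symbol_at G d).
  rewrite (h0 d bd) {2}/h2 bd /=; have := smallA d dd bd; rewrite -/(h _) /h2.
  case: (boolP (branch (nxt d))) => bd1 /=.
    by rewrite (h0 _ bd1) /=; case: ifP; lia.
  by case: ifP => /eqP; lia.
rewrite hS // {2}/h2 (negPf bd) /= /h2.
case: ifP => [/andP[bd1 /eqP]|_]; last by lia.
by move=> h2E; case: (smallB d dd bd bd1).
Qed.

End Discharging.

(** * Certificates for words of turns *)

(* What a word of boundary symbols says about membership in [G], in the coordinates
   where the walk starts at [dart0]. *)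
Definition facts_at (d : dart) (c : symbol) : seq (lattice_point * bool) :=
  (d.1, true) :: zip (neighbors d) (code c).

Fixpoint facts (d : dart) (w : seq symbol) : seq (lattice_point * bool) :=
  if w is c :: w' then facts_at d c ++ facts (step d c) w' else [::].

Fixpoint trail (d : dart) (w : seq symbol) : seq lattice_point :=
  if w is c :: w' then (step d c).1 :: trail (step d c) w' else [::].

Definition end_dart (d : dart) (w : seq symbol) : dart := foldl step d w.

Definition dart0 : dart := (origin, hex 0).

Section Certificates.
Variable fs : seq (lattice_point * bool).

Definition known (b : bool) (a : lattice_point) : bool := (a, b) \in fs.

Definition known_degree (n : nat) (a : lattice_point) : bool :=
  all (fun b => known true b || known false b) (neighbors (a, hex 0)) &&
  (count (known true) (neighbors (a, hex 0)) == n).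

Definition chordlessb x (p : seq lattice_point) : bool :=
  all (fun i => all (fun j =>
    lattice_adj (nth x (x :: p) i) (nth x (x :: p) j) ==> (j == i.+1) || (i == j.+1))
    (iota 0 (size p).+1)) (iota 0 (size p).+1).

Definition handle_cert x (p : seq lattice_point) : bool :=
  [&& all (known true) (x :: p), path lattice_adj x p, uniq (x :: p), chordlessb x p &
      all (fun i => known_degree 2 (nth x (x :: p) i)) (iota 1 (size p).-1)].

Definition parity_cert x (p q : seq lattice_point) : bool :=
  [&& handle_cert x p, all (known true) (x :: q), path lattice_adj x q, uniq (x :: q),
      last x q == last x p, q != p, size q <= size p, odd (size q) == odd (size p) &
      all (fun i => nth x (x :: p) i \notin x :: q) (iota 1 (size p).-1)].

Definition conflict : bool := has (fun a => a.2 && known false a.1) fs.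

End Certificates.

(** * Soundness of the certificates *)

Section Soundness.
Variables (V : {fset lattice_point}) (r u : lattice_point).
Hypothesis (uU : u \in units).
Variable fs : seq (lattice_point * bool).

Definition holds : bool := all (fun a => (frame r u a.1 \in V) == a.2) fs.

Hypothesis fsV : holds.

Notation fr := (frame r u).

Lemma knownP b a : known fs b a -> (fr a \in V) = b.
Proof. by move/(allP fsV)/eqP. Qed.

Lemma conflictF : conflict fs = false.
Proof.
apply/negP => /hasP[[a b] ab /= /andP[b1 /knownP aV]].
by have := allP fsV _ ab; rewrite /= aV b1.
Qed.

Lemma neighbors_frame a v : neighbors (fr a, frame origin u v) = map fr (neighbors (a, v)).
Proof. by rewrite -map_comp; apply: eq_map => i; rewrite /nb /= frame_comp. Qed.

Lemma known_degreeP n a : known_degree fs n a -> degree lattice_adj V (fr a) = n.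
Proof.
case/andP=> /allP kn /eqP <-.
rewrite (degree_pattern _ _ (lin_units 0 uU)) /pattern neighbors_frame -map_comp count_map.
apply: eq_in_count => b /kn /= /orP[] kb; rewrite (knownP kb) ?kb //.
by apply/esym/negP=> /knownP; rewrite (knownP kb).
Qed.

Lemma all_known s : all (known fs true) s -> all (mem V) (map fr s).
Proof. by move/allP=> kn; apply/allP => _ /mapP[a /kn/knownP aV ->]; rewrite /= aV. Qed.

Lemma nth_frame x p i : i <= size p -> nth (fr x) (fr x :: map fr p) i = fr (nth x (x :: p) i).
Proof. by move=> ip; rewrite -map_cons (nth_map x). Qed.

Lemma frame_path x p : path lattice_adj (fr x) (map fr p) = path lattice_adj x p.
Proof. by rewrite path_map; apply: eq_path => a b /=; rewrite adj_frame. Qed.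

Lemma frame_is_path (W : {fset lattice_point}) x p :
  all (mem W) (map fr (x :: p)) -> path lattice_adj x p -> uniq (x :: p) ->
  is_path lattice_adj W (fr x) (map fr p).
Proof.
move=> aW pp up; apply/and3P; split=> //; first by rewrite frame_path.
by rewrite -map_cons map_inj_uniq //; apply: frame_inj.
Qed.

Lemma handle_certP x p : handle_cert fs x p ->
  is_handle lattice_adj V (size p) (fr x) (map fr p).
Proof.
case/and5P=> kn pp up /allP cp /allP dp; rewrite -(size_map fr p).
apply: handle_intro => [|i j|i]; rewrite ?size_map.
- by apply: frame_is_path => //; apply: all_known.
- move=> ip jp; rewrite !nth_frame // adj_frame // => adjij.
  have /cp/allP/(_ j) : i \in iota 0 (size p).+1 by rewrite mem_iota.
  by rewrite mem_iota adjij => /(_ jp) /orP[]/eqP; auto.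
move=> /andP[i0 ip]; rewrite nth_frame ?(ltnW ip) //; apply/known_degreeP/dp.
by rewrite mem_iota i0; lia.
Qed.

Lemma parity_certP x p q : parity_cert fs x p q ->
  is_parity_handle lattice_adj V (size p) (fr x) (map fr p).
Proof.
case/and5P=> hp kq pq uq /and5P[/eqP lq qp sq /eqP oq /allP iq].
have := handle_certP hp; split=> //; exists (map fr q); split.
- apply: frame_is_path => //; have /allP kV := all_known kq.
  apply/allP => _ /mapP[a aq ->] /=.
  have aV : fr a \in V by apply: kV; apply: map_f.
  rewrite in_fsetD aV andbT.
  have [_ _ ch _] := handle_certP hp.
  apply/negP => /(interior_nth ch)[i]; rewrite size_map => /andP[i0 ip].
  rewrite nth_frame ?(ltnW ip) // => /(frame_inj uU) ai.
  have /iq/negP[] : i \in iota 1 (size p).-1 by rewrite mem_iota i0; lia.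
  by rewrite -ai.
- by rewrite !last_map lq.
- by move/(inj_map (frame_inj uU)); apply/eqP.
- by rewrite size_map.
by rewrite size_map !modn2 oq.
Qed.

End Soundness.

Section Words.
Variables G S : {fset lattice_point}.
Hypotheses (hexG : hexagonal G) (degG : forall a, a \in G -> 1 < degree lattice_adj G a).
Hypotheses (GS : G `<=` S)
  (GbdS : forall a b, a \in S -> lattice_adj a b -> b \notin S -> a \in G).

(** The dart with coordinates [dl] relative to [d]; by [glob_step] it commutes with the walk, so
    facts computed from [dart0] transfer to every dart. *)
Definition glob (d dl : dart) : dart := (frame d.1 d.2 dl.1, frame origin d.2 dl.2).

Lemma glob0 d : glob d dart0 = d.
Proof.
case: d => r [u1 u2]; rewrite /glob frame_origin; congr pair.
by congr pair => /=; ring.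
Qed.

Lemma glob_step d dl c : glob d (step dl c) = step (glob d dl) c.
Proof.
by rewrite /glob /step /nb /= frame_comp lin_comp.
Qed.

Lemma facts_word d dl n : d.2 \in units -> is_dart S (glob d dl) ->
  holds G d.1 d.2 (facts dl (word G n (glob d dl))).
Proof.
move=> uU; elim: n dl => //= n IHn dl dd.
have [dG pE _ _] := dart_pattern hexG degG GS GbdS dd.
have := IHn (step dl (symbol_at G (glob d dl))); rewrite glob_step => IH.
rewrite /holds /= all_cat dG eqxx /=; apply/andP; split; last first.
  exact: IH (advance_dart hexG degG GS GbdS dd).
rewrite -pE /pattern; case: dl {dd dG pE IH} => a v; rewrite /glob neighbors_frame.
by elim: (neighbors _) => //= b s IHs; rewrite eqxx.
Qed.

Lemma facts0 d n w : is_dart S d -> word G n d = w -> holds G d.1 d.2 (facts dart0 w).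
Proof.
move=> dd <-; have /and3P[_ uU _] := dd.
by have := @facts_word d dart0 n uU; rewrite glob0; apply.
Qed.

End Words.

(** * Inspection of the words of bounded length *)

Fixpoint all_words (n : nat) (P : seq symbol -> bool) : bool :=
  if n is n'.+1 then
    [&& all_words n' (fun w => P (Convex :: w)), all_words n' (fun w => P (Straight :: w)) &
        all_words n' (fun w => P (Concave :: w))]
  else P [::].

Lemma all_wordsP n P w : all_words n P -> size w = n -> ~~ has is_branch w -> P w.
Proof.
elim: n P w => [P [|]//|n IHn P [|[] w] //= /and3P[P1 P2 P3] [sw] bw].
- exact: (IHn _ _ P1).
- exact: (IHn _ _ P2).
- exact: (IHn _ _ P3).
Qed.

(* Such a walk closes up around a hexagon, and is not a handle. *)
Definition hexagon_word (w : seq symbol) : bool :=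
  match w with
  | [:: Convex, Convex, Convex, Convex & _] => true
  | [:: Concave, Concave, Concave, Concave & _] => true
  | _ => false
  end.

Lemma three_cert : all_words 3 (fun w =>
  handle_cert (facts dart0 w) (hex 0) (origin :: trail dart0 w)).
Proof. by vm_compute. Qed.

Lemma five_cert : all_words 5 (fun w =>
  [|| handle_cert (facts dart0 w) (hex 0) (origin :: trail dart0 w),
      hexagon_word w | hexagon_word (behead w)]).
Proof. by vm_compute. Qed.

(** The handle has the first three vertices of the walk as interior; the remaining vertex of the
    hexagon gives the second path, of length 2. *)
Lemma hexagon_cert : all_words 4 (fun w => hexagon_word w ==>
  parity_cert (facts dart0 w) (hex 0) (origin :: trail dart0 (take 3 w))
    [:: last origin (trail dart0 w); last origin (trail dart0 (take 3 w))]).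
Proof. by vm_compute. Qed.

Definition pt (a b : int) : lattice_point := (a, b).

(* The second path of the parity handle spanned by [Branch :: w ++ [:: Branch]]. *)
Definition detour (w : seq symbol) : seq lattice_point :=
  match w with
  | [:: Convex; Convex] => [:: pt 0 (-1); pt (-1) (-1); pt (-2) 0]
  | [:: Convex; Convex; Convex] => [:: pt 0 (-1); pt (-1) (-1)]
  | [:: Convex; Convex; Straight] =>
      [:: pt 0 (-1); pt 0 (-2); pt (-1) (-2); pt (-2) (-1)]
  | [:: Convex; Straight; Convex] =>
      [:: pt 0 (-1); pt (-1) (-1); pt (-2) (-1); pt (-3) 0]
  | [:: Convex; Convex; Straight; Convex] => [:: pt 0 (-1); pt 0 (-2); pt (-1) (-2)]
  | [:: Convex; Straight; Convex; Convex] => [:: pt 0 (-1); pt (-1) (-1); pt (-2) (-1)]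
  | _ => [::]
  end%R.

Definition block_facts (w : seq symbol) := facts dart0 (Branch :: rcons w Branch).

Definition block_trail (w : seq symbol) := trail dart0 (Branch :: w).

Definition parity_block (w : seq symbol) : bool :=
  parity_cert (block_facts w) origin (block_trail w) (detour w).

(** A sum above 2 needs three [Convex] and at most one more letter, [Straight] or [Convex]. Four
    [Convex] form a hexagon; the other words are contradictory or, with the detour, give a PP(4) or
    PP(5). *)
Lemma steep_cert n : n < 5 -> all_words n (fun w =>
  [|| (block_sum w <= 2)%R, hexagon_word w, conflict (block_facts w) |
      (2 < size w) && parity_block w]).
Proof. by case: n => [|[|[|[|[|]]]]] // _; vm_compute. Qed.

Lemma two_cert : all_words 2 (fun w => (block_sum w <= 1)%R || parity_block w).
Proof. by vm_compute. Qed.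

(* The edge at the branch vertex [d.1] that the boundary walk does not follow, seen from
   its other end. *)
Definition spur (d : dart) : dart := (nb d 4, frame origin d.2 (hex 1)).

(** What holds when the spur at the second branch vertex ends in a vertex of degree 3: the further
    neighbors of that vertex are at positions 2 and 4. *)
Definition spur_facts (w : seq symbol) : seq (lattice_point * bool) :=
  let d := spur (end_dart dart0 (Branch :: w)) in
  [:: (nb d 2, true), (nb d 4, true) & block_facts w].

(** The handle serves as center of an H-handle when the spur ends in a vertex of degree 2; otherwise
    the extra facts give a PP(4) or a contradiction. *)
Lemma H_cert : all_words 3 (fun w => (block_sum w == 2%R) ==>
  handle_cert (block_facts w) origin (block_trail w) &&
  (conflict (spur_facts w) ||
   parity_cert (spur_facts w) origin (block_trail w) (detour w))).
Proof. by vm_compute. Qed.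

Lemma S_cert : all_words 4 (fun w => (block_sum w == 2%R) ==>
  conflict (block_facts w) || handle_cert (block_facts w) origin (block_trail w)).
Proof. by vm_compute. Qed.

Lemma short_block w : ~~ has is_branch w -> size w < 2 -> (block_sum w <= 1)%R.
Proof. by case: w => [|[] [|[]]]. Qed.

Definition has_handle (F : seq handle_type) V : Prop :=
  exists t x p, t \in F /\ handle_of_type lattice_adj V t x p.

Lemma has_handleS F F' V : {subset F <= F'} -> has_handle F V -> has_handle F' V.
Proof. by move=> FF [t [x [p [/FF tF h]]]]; exists t, x, p. Qed.

(** Triangle-freeness bounds the degree by 3 and makes three neighbors alternate around [r]. *)
Lemma spur_neighbors V r u : hexagonal V -> r \in V -> u \in units ->
  nb (r, u) 0 \in V -> 1 < degree lattice_adj V r -> degree lattice_adj V r != 2 ->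
  nb (r, u) 2 \in V /\ nb (r, u) 4 \in V.
Proof.
move=> hexV rV uU; have := pattern_triangle_free hexV rV uU.
rewrite (degree_pattern _ _ uU) -!nth_pattern //.
move: (pattern V (r, u)) (size_pattern V (r, u)); apply: size6P => a b c d e f.
by case: a b c d e f => [] [] [] [] [] [].
Qed.

(** * Handles found along the boundary *)

Section BoundaryWords.
Variables G S : {fset lattice_point}.
Hypotheses (hexG : hexagonal G) (degG : forall a, a \in G -> 1 < degree lattice_adj G a).
Hypotheses (GS : G `<=` S)
  (GbdS : forall a b, a \in S -> lattice_adj a b -> b \notin S -> a \in G).

Notation nxt := (advance G).
Notation branch d := (is_branch (symbol_at G d)).
Let wordP := facts0 hexG degG GS GbdS.
Let patP := dart_pattern hexG degG GS GbdS.
Let nxtP := advance_dart hexG degG GS GbdS.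

Lemma dart_units d : is_dart S d -> d.2 \in units.
Proof. by case/and3P. Qed.

Lemma size_word n d : size (word G n d) = n.
Proof. by elim: n d => //= n IHn d; rewrite IHn. Qed.

Lemma size_trail d w : size (trail d w) = size w.
Proof. by elim: w d => //= c w IHw d; rewrite IHw. Qed.

Lemma dart_degree d : is_dart S d -> degree lattice_adj G d.1 = if branch d then 3 else 2.
Proof.
move=> dd; have [_ pE _ _] := patP dd.
have := degree_pattern G d.1 (dart_units dd); rewrite -surjective_pairing pE => ->.
by case: (symbol_at G d).
Qed.

Lemma degree2_P2 d : is_dart S d -> ~~ branch d -> has_handle [:: HandleP 2] G.
Proof.
move=> dd nb0; have deg2 := dart_degree dd; rewrite (negPf nb0) in deg2.
have [dG pE _ _] := patP dd.
have uU := dart_units dd.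
have in0 : nb d 0 \in G by rewrite -nth_pattern // pE; case: (symbol_at G d).
have [z z0 /andP[zG dz]] : exists2 z, z != nb d 0 & (z \in G) && lattice_adj d.1 z.
  by apply: other_neighbor; rewrite deg2.
exists (HandleP 2), (nb d 0), [:: d.1; z]; split; first by rewrite inE.
apply: (cherry_handle adj_sym adj_irr) => //.
by rewrite adj_sym (surjective_pairing d) adj_nb.
Qed.

Lemma no_three d : is_dart S d -> ~~ has is_branch (word G 3 d) ->
  has_handle [:: HandleP 4] G.
Proof.
move=> dd nbr; have := all_wordsP three_cert (size_word 3 d) nbr.
move/(handle_certP (dart_units dd) (wordP dd erefl)) => h.
by exists (HandleP 4); do 2!eexists; split; last exact: h; rewrite !inE eqxx ?orbT.
Qed.

Lemma no_hexagon d : is_dart S d -> ~~ has is_branch (word G 4 d) ->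
  hexagon_word (word G 4 d) -> has_handle [:: HandlePP 4] G.
Proof.
move=> dd nbr hw; have := all_wordsP hexagon_cert (size_word 4 d) nbr.
rewrite hw; move/(parity_certP (dart_units dd) (wordP dd erefl)) => h.
by exists (HandlePP 4); do 2!eexists; split; last exact: h; rewrite !inE eqxx ?orbT.
Qed.

Lemma no_five d : is_dart S d -> ~~ has is_branch (word G 5 d) ->
  has_handle [:: HandleP 6; HandlePP 4] G.
Proof.
have sub : {subset [:: HandlePP 4] <= [:: HandleP 6; HandlePP 4]}.
  by move=> t tF; rewrite inE tF orbT.
move=> dd nbr; have := all_wordsP five_cert (size_word 5 d) nbr; case/or3P=> [|hw|hw].
- move/(handle_certP (dart_units dd) (wordP dd erefl)) => h.
  by exists (HandleP 6); do 2!eexists; split; last exact: h; rewrite !inE eqxx ?orbT.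
- apply/(has_handleS sub)/(no_hexagon dd) => //.
  by apply: contra nbr => /=; do 5!case: (is_branch _).
- apply/(has_handleS sub)/(no_hexagon (nxtP dd)) => //.
  by apply: contra nbr => /= ->; rewrite orbT.
Qed.

Definition family3 : seq handle_type :=
  [:: HandleP 6; HandlePP 3; HandlePP 4; HandlePP 5; HandleS 5 2 1; HandleH 1 2 4 2 1].

Lemma family3_PP n : 2 < n < 6 -> HandlePP n \in family3.
Proof.
by rewrite !inE; case: n => [|[|[|[|[|[|]]]]]] // _; rewrite eqxx ?orbT.
Qed.

Lemma steep_block d w : is_dart S d -> size w < 5 -> ~~ has is_branch w ->
  word G (size w).+2 d = Branch :: rcons w Branch ->
  (block_sum w <= 2)%R \/ has_handle family3 G.
Proof.
move=> dd w5 nbr wE; have fsG := wordP dd wE; have uU := dart_units dd.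
have := all_wordsP (steep_cert w5) erefl nbr.
case/or4P=> [|hw||/andP[w2 pw]]; [by left| |by rewrite (conflictF fsG)|]; right.
  have w4 : size w = 4 by move: hw w5; case: (w) => [|[] [|[] [|[] [|[] [|]]]]].
  have wE' : word G 4 (nxt d) = w.
    have := congr1 (fun s => take 4 (behead s)) wE; rewrite /= -cats1 take_size_cat // => <-.
    by rewrite w4.
  have := no_hexagon (nxtP dd); rewrite wE' => /(_ nbr hw) [t [x [p [+ h]]]].
  rewrite inE => /eqP tE; exists t, x, p; split=> //.
  by rewrite tE family3_PP.
have h := parity_certP uU fsG pw.
exists (HandlePP (size (block_trail w))); do 2!eexists; split; last exact: h.
by rewrite family3_PP // size_trail /=; lia.
Qed.

Lemma two_block d w : is_dart S d -> size w = 2 -> ~~ has is_branch w ->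
  word G 4 d = Branch :: rcons w Branch ->
  (block_sum w <= 1)%R \/ has_handle [:: HandlePP 3] G.
Proof.
move=> dd w2 nbr wE; have fsG := wordP dd wE; have uU := dart_units dd.
have := all_wordsP two_cert w2 nbr; case/orP=> [|pw]; [by left|right].
have h := parity_certP uU fsG pw.
exists (HandlePP 3); do 2!eexists; split; first by rewrite inE.
by move: h; rewrite size_trail /= w2; apply.
Qed.

(** A branch vertex has its neighbors at 0, 2, 4: [j] starts the central handle, [i] the handle of
    length 2, and the remaining edge is the handle of length 1. *)
Lemma dart_fork d p : is_dart S d -> branch d ->
  forall i j, i \in [:: 0; 2; 4] -> j \in [:: 0; 2; 4] -> i != j ->
  head d.1 p = nb d j -> degree lattice_adj G (nb d i) = 2 ->
  fork lattice_adj G 2 1 d.1 p /\ fork lattice_adj G 1 2 d.1 p.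
Proof.
move=> dd bd i j iT jT ij hE degi; have uU := dart_units dd.
have [dG pE _ _] := patP dd.
have nbG k : k \in [:: 0; 2; 4] -> nb d k \in G.
  move=> kT; rewrite -nth_pattern ?pE; last by move: kT; rewrite !inE => /or3P[]/eqP->.
  by move: bd kT; case: (symbol_at G d) => // _; rewrite !inE => /or3P[]/eqP->.
have adjd k : lattice_adj d.1 (nb d k) by rewrite (surjective_pairing d) adj_nb.
apply: (fork_intro adj_sym adj_irr hexG dG _ (nbG i iT) (adjd i) degi); rewrite ?hE ?nbG //.
  by rewrite (dart_degree dd) bd.
rewrite (inj_eq (frame_inj uU)); apply: contra ij => /eqP /hex_inj -> //.
  by move: iT; rewrite !inE => /or3P[]/eqP->.
by move: jT; rewrite !inE => /or3P[]/eqP->.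
Qed.

Lemma four_S d w : is_dart S d -> degree lattice_adj G (nb d 0) = 2 ->
  size w = 4 -> ~~ has is_branch w -> word G 6 d = Branch :: rcons w Branch ->
  block_sum w = 2%R -> has_handle [:: HandleS 5 2 1] G.
Proof.
move=> dd deg0 w4 nbr wE sum2; have fsG := wordP dd wE; have uU := dart_units dd.
have bd : branch d by case: wE => -> _.
have := all_wordsP S_cert w4 nbr; rewrite sum2 eqxx (conflictF fsG) /=.
move/(handle_certP uU fsG); rewrite size_trail /= w4 frame_origin => h.
exists (HandleS 5 2 1); do 2!eexists; split; first by rewrite inE.
split; first exact: h.
have hE : head d.1 [seq frame d.1 d.2 a | a <- block_trail w] = nb d 2 by [].
by have [] := @dart_fork d _ dd bd 0 2 isT isT isT hE deg0.
Qed.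

Lemma three_H d w : is_dart S d -> degree lattice_adj G (nb d 0) = 2 ->
  size w = 3 -> ~~ has is_branch w -> word G 5 d = Branch :: rcons w Branch ->
  block_sum w = 2%R -> has_handle [:: HandlePP 4; HandleH 1 2 4 2 1] G.
Proof.
move=> dd deg0 w3 nbr wE sum2; have fsG := wordP dd wE; have uU := dart_units dd.
have bd : branch d by case: wE => -> _.
have := all_wordsP H_cert w3 nbr; rewrite sum2 eqxx /= => /andP[hcert scert].
have := handle_certP uU fsG hcert; rewrite size_trail /= w3 frame_origin => h.
case: w w3 wE {nbr sum2 fsG hcert} scert h => [|c1 [|c2 [|c3 [|]]]] // _.
case=> b0 s1 s2 s3 s4 scert h.
set w := [:: c1; c2; c3] in scert h *.
(* The dart at the second branch vertex, whose spur ends in [nb e 4]. *)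
pose e := nxt (nxt (nxt (nxt d))).
have ed : is_dart S e by do 4!apply: nxtP.
have eb : branch e by rewrite s4.
have eE : glob d (end_dart dart0 (Branch :: w)) = e.
  by rewrite /= !glob_step glob0 /e {1}/advance s3 {1}/advance s2 {1}/advance s1 /advance b0.
have [spur2|spurN] := eqVneq (degree lattice_adj G (nb e 4)) 2.
  pose p := [seq frame d.1 d.2 a | a <- block_trail w].
  exists (HandleH 1 2 4 2 1), d.1, p; split; first by rewrite !inE eqxx ?orbT.
  split; first exact: h.
    have hE : head d.1 p = nb d 2 by [].
    by have [] := @dart_fork d _ dd bd 0 2 isT isT isT hE deg0.
  have -> : last d.1 p = e.1.
    by rewrite -eE.
  have hE : head e.1 (rev (belast d.1 p)) = nb e 0.
    by rewrite -eE [end_dart _ _]/= glob_step nb_step0.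
  by have [] := @dart_fork e _ ed eb 4 0 isT isT isT hE spur2.
have eU := dart_units ed.
have [eG pE _ _] := patP ed.
have e4 : nb e 4 \in G by rewrite -nth_pattern // pE; move: eb; case: (symbol_at G e).
have sU : (spur e).2 \in units by apply: lin_units.
have nb_spur i : nb (spur e) i = frame e.1 e.2 (frame (hex 4) (hex 1) (hex i)).
  by rewrite -frame_comp.
have s0 : nb (spur e) 0 \in G.
  by rewrite nb_spur (_ : frame (hex 4) _ _ = origin) // frame_origin.
have [in2 in4] := spur_neighbors hexG e4 sU s0 (degG e4) spurN.
have fsG : holds G d.1 d.2 (block_facts w).
  by apply: (wordP (n := 5) dd); rewrite /= b0 s1 s2 s3 s4.
have fsG' : holds G d.1 d.2 (spur_facts w).
  have globE i : frame d.1 d.2 (nb (spur (end_dart dart0 (Branch :: w))) i) = nb (spur e) i.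
    rewrite nb_spur -eE /glob frame_comp; congr frame.
    by rewrite /spur {1}/nb -frame_comp.
  by apply/and3P; split=> //=; rewrite globE ?in2 ?in4.
move: scert; rewrite (conflictF fsG') /= => /(parity_certP uU fsG').
rewrite size_trail /= => h4.
by exists (HandlePP 4); do 2!eexists; split; last exact: h4; rewrite inE eqxx.
Qed.

Lemma flat_block d w : is_dart S d -> degree lattice_adj G (nb d 0) = 2 ->
  size w < 5 -> ~~ has is_branch w -> word G (size w).+2 d = Branch :: rcons w Branch ->
  block_sum w = 2%R -> has_handle family3 G.
Proof.
move=> dd deg0 w5 nbr wE sum2.
case sw : (size w) w5 wE => [|[|[|[|[|]]]]] // _ wE.
- by have := short_block nbr; rewrite sum2 sw => /(_ isT).
- by have := short_block nbr; rewrite sum2 sw => /(_ isT).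
- have [|] := two_block dd sw nbr wE; first by rewrite sum2.
  by apply: has_handleS => t; rewrite !inE => /eqP ->; rewrite eqxx ?orbT.
- apply: has_handleS (three_H dd deg0 sw nbr wE sum2) => t.
  by rewrite !inE => /orP[]/eqP ->; rewrite eqxx ?orbT.
apply: has_handleS (four_S dd deg0 sw nbr wE sum2) => t.
by rewrite !inE => /eqP ->; rewrite eqxx ?orbT.
Qed.

End BoundaryWords.

(** * Cores *)

(** Contrapositive of [discharge]: the filling of [V] has positive curvature, so one of the three
    conditions there fails at some dart, and each failure yields [P]. *)
Lemma block_alternative V N (P : Prop) : 0 < N -> hexagonal V -> V != fset0 ->
  (forall a, a \in V -> 1 < degree lattice_adj V a) ->
  (forall S, V `<=` S ->
     (forall a b, a \in S -> lattice_adj a b -> b \notin S -> a \in V) ->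
     [/\ forall d, is_dart S d -> ~~ has is_branch (word V N d) -> P,
         forall d w, is_dart S d -> size w < N -> ~~ has is_branch w ->
           word V (size w).+2 d = Branch :: rcons w Branch -> (2 < block_sum w)%R -> P &
         forall d w, is_dart S d -> degree lattice_adj V (nb d 0) = 2 ->
           size w < N -> ~~ has is_branch w ->
           word V (size w).+2 d = Branch :: rcons w Branch -> block_sum w = 2%R -> P]) ->
  P.
Proof.
move=> N0 hexV /fset0Pn[a aV] degV alt.
have [S [hS VS VbdS]] := hole_free_filling V.
have curvS := hole_free_curvature_gt0 hS (fsubsetP VS a aV).
have [alt1 alt2 alt3] := alt S VS VbdS.
have nxtP := advance_dart hexV degV VS VbdS.
have [/allP all1|/allPn[d]] := boolP (all (fun d => has is_branch (word V N d)) (darts S));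
  last by rewrite mem_darts; apply: alt1.
have hasb d : is_dart S d -> has is_branch (word V N d) by rewrite -mem_darts; apply: all1.
have branchE d : is_branch (symbol_at V d) -> symbol_at V d = Branch.
  by case: (symbol_at V d).
have blockE d : is_dart S d -> is_branch (symbol_at V d) ->
    let w := block V N (advance V d) in
    [/\ size w < N, ~~ has is_branch w & word V (size w).+2 d = Branch :: rcons w Branch].
  move=> dd bd w; have [sw nw wE] := word_block (hasb _ (nxtP _ dd)).
  split=> //.
  change (symbol_at V d :: word V (size w).+1 (advance V d) = Branch :: rcons w Branch).
  by rewrite wE branchE.
have [/allP all2|/allPn[d]] := boolP (all (fun d => is_branch (symbol_at V d) ==>
    (block_sum (block V N (advance V d)) <= 2)%R) (darts S)); last first.
  rewrite mem_darts => dd; rewrite negb_imply -ltNge => /andP[bd lt2].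
  by have [sw nw wE] := blockE d dd bd; apply: (alt2 d _ dd sw nw wE lt2).
have [/allP all3|/allPn[d]] := boolP (all (fun d => ~~ [&& ~~ is_branch (symbol_at V d),
    is_branch (symbol_at V (advance V d)) &
    block_sum (block V N (advance V (advance V d))) == 2%R]) (darts S)); last first.
  rewrite mem_darts negbK => dd /and3P[nbd bd /eqP sum2].
  have [sw nw wE] := blockE _ (nxtP d dd) bd.
  apply: (alt3 _ _ (nxtP d dd) _ sw nw wE sum2).
  by rewrite nb_step0 (dart_degree hexV degV VS VbdS dd) (negPf nbd).
exfalso; move: curvS; rewrite ltNge => /negP; apply.
apply: (discharge hexV degV VS VbdS N0 hasb) => [d dd bd|d dd nbd bd sum2].
  by have := all2 d; rewrite mem_darts bd; apply.
by have := all3 d; rewrite mem_darts nbd bd sum2 eqxx => /(_ dd).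
Qed.

Lemma block_sum_size w : (block_sum w <= (size w)%:Z)%R.
Proof. by elim: w => //= -[] w IHw; rewrite /turning /=; lia. Qed.

Definition family1 : seq handle_type := [:: HandleP 2].

Definition family2 : seq handle_type := [:: HandleP 4; HandlePP 3].

Section MinDegreeTwo.
Variable V : {fset lattice_point}.
Hypotheses (hexV : hexagonal V) (V0 : V != fset0).
Hypothesis (degV : forall a, a \in V -> 1 < degree lattice_adj V a).

Lemma has_handle1 : has_handle family1 V.
Proof.
apply: (block_alternative (V := V) (N := 1)) => // S VS bS; split=> [d dd /=|d w|d w].
- by rewrite orbF; apply: degree2_P2 dd.
- by case: w.
- by case: w.
Qed.

(** Three turns without a branch give a P(4). Shorter blocks have sum at most 2, with equality only
    for two [Convex], where a PP(3) arises. *)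
Lemma has_handle2 : has_handle family2 V.
Proof.
apply: (block_alternative (V := V) (N := 3)) => // S VS bS.
split=> [d dd nbr|d w _ sw _ _|d w dd _ sw nbr wE].
- apply: has_handleS (no_three hexV degV VS bS dd nbr) => t.
  by rewrite !inE => /eqP ->; rewrite eqxx.
- by have := block_sum_size w; lia.
move=> sum2; have w2 : size w = 2 by have := block_sum_size w; lia.
rewrite w2 in wE; have [|] := two_block hexV degV VS bS dd w2 nbr wE; first by rewrite sum2.
by apply: has_handleS => t; rewrite !inE => /eqP ->; rewrite eqxx orbT.
Qed.

(** Five turns without a branch give a P(6) or a hexagon with its PP(4). Blocks of sum above 2 give
    parity handles; blocks of sum 2 give PP(3), PP(4) or H, or S, according to their length 2, 3 or
    4. *)
Lemma has_handle3 : has_handle family3 V.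
Proof.
apply: (block_alternative (V := V) (N := 5)) => // S VS bS.
split=> [d dd nbr|d w dd sw nbr wE|d w dd].
- apply: has_handleS (no_five hexV degV VS bS dd nbr) => t.
  by rewrite !inE => /orP[]/eqP ->; rewrite eqxx ?orbT.
- by have [|] := steep_block hexV degV VS bS dd sw nbr wE; first by lia.
- exact: (flat_block hexV degV VS bS dd).
Qed.

End MinDegreeTwo.

Definition nondegenerate (t : handle_type) : bool :=
  match t with
  | HandleP n => 1 < n
  | HandlePP n => 1 < n
  | HandleS n _ _ => 1 < n
  | HandleH _ _ n _ _ => 1 < n
  end.

Lemma handle_of_type_handle V t x p : handle_of_type lattice_adj V t x p ->
  exists2 n, is_handle lattice_adj V n x p & nondegenerate t -> 1 < n.
Proof.
by case: t => [n h|n [h _]|n1 n2 n3 [h _]|n1 n2 n n3 n4 [h _ _]]; exists n || exists n1.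
Qed.

Section Core.
Variable F : seq handle_type.
Hypothesis F_pos : all nondegenerate F.
Hypothesis F_has : forall V, hexagonal V -> V != fset0 ->
  (forall a, a \in V -> 1 < degree lattice_adj V a) -> has_handle F V.

Lemma hexagonal_sub V W : W `<=` V -> hexagonal V -> hexagonal W.
Proof. by move=> /fsubsetP sub hV x y z /sub xV /sub yV /sub; apply: hV. Qed.

Lemma deletions_sub V W : deletions lattice_adj F V W -> W `<=` V.
Proof.
elim=> {W} [|W C _ sub] //.
by case=> [x _ _|t x p _ _]; apply: fsubset_trans sub; apply: fsubsetDl.
Qed.

(** Greedy deletion: while vertices remain, one has degree at most 1, or [F_has] gives a handle with
    nonempty interior. *)
Lemma deletions_fset0 G : hexagonal G -> deletions lattice_adj F G fset0.
Proof.
move=> hexG.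
suff del n (W : {fset lattice_point}) : #|` W| < n ->
    deletions lattice_adj F G W -> deletions lattice_adj F G fset0.
  by apply: del (ltnSn _) _; constructor.
elim: n W => // n IHn W Wn delW.
have [W0|W0] := eqVneq W fset0; first by rewrite -W0.
have [/allP deg2|/allPn[a aW]] := boolP (all (fun a => 1 < degree lattice_adj W a) W);
    last first.
  rewrite -leqNgt => dega; apply: (IHn (W `\ a)).
    by move: Wn; rewrite (cardfsD1 a) aW; lia.
  by apply: OneMoreDeletion delW _; apply: DeleteVertex.
have hexW := hexagonal_sub (deletions_sub delW) hexG.
have [t [x [p [tF h]]]] := F_has hexW W0 deg2.
apply: (IHn (W `\` interior lattice_adj x p)); last first.
  by apply: OneMoreDeletion delW _; apply: DeleteInterior h.
have [m hm /(_ (allP F_pos t tF)) m1] := handle_of_type_handle h.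
have /fset0Pn[y yI] := interior_neq0 adj_sym m1 hm.
have yW : y \in W.
  have [/and3P[/allP pW _ _] _ _ _] := hm; apply: pW.
  by move: yI; rewrite !inE /= => /andP[].
have sub : W `\` interior lattice_adj x p `<=` W `\ y by rewrite fsetDS // fsub1set.
by have := fsubset_leq_card sub; move: Wn; rewrite (cardfsD1 y W) yW; lia.
Qed.

(** A nonempty core would have minimum degree 2, hence a handle in [F]; conversely the empty set is
    reachable and contains no path. *)
Lemma core_fset0 G C : hexagonal G -> is_core lattice_adj F G C <-> C = fset0.
Proof.
move=> hexG; split=> [[delC degC noh]|->]; last first.
  split=> [|x|t x p _ h]; [exact: deletions_fset0|by rewrite inE|].
  have [m [/and3P[/andP[]]]] := handle_of_type_handle h.
  by rewrite /= inE.
apply/eqP/negPn/negP => C0.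
have [t [x [p [tF h]]]] := F_has (hexagonal_sub (deletions_sub delC) hexG) C0 degC.
exact: noh h.
Qed.

End Core.

Theorem theorem6 (G : {fset lattice_point}) (hG : hexagonal G)
    (C : {fset lattice_point}) :
  [/\ is_core lattice_adj [:: HandleP 2] G C <-> C = fset0,
      is_core lattice_adj [:: HandleP 4; HandlePP 3] G C <-> C = fset0 &
      is_core lattice_adj
        [:: HandleP 6; HandlePP 3; HandlePP 4; HandlePP 5;
            HandleS 5 2 1; HandleH 1 2 4 2 1] G C <-> C = fset0].
Proof.
split; apply: core_fset0 => //.
- exact: has_handle1.
- exact: has_handle2.
- exact: has_handle3.
Qed.
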